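(* Let $q_A:A\to M$ be a vector bundle and $k\ge1$. There is a one-to-one correspondence between linear $k$-forms $\Lambda\in\Omega^k(A)$, covering a map $\lambda:\oplus^{k-1}TM\to A^*$, and pairs $(\mu,\nu)$, where $\mu:A\to\wedge^{k-1}T^*M$ and $\nu:A\to\wedge^kT^*M$ are vector-bundle morphisms (over the identity of $M$). The correspondence is given by $$\Lambda=\mathrm{d}\Lambda_\mu+\Lambda_\nu,$$ where $\mu=(-1)^{k-1}\lambda^t$.
   Context: $TA$ is a vector bundle over $A$ and also over $TM$ via $Tq_A$. $\oplus^{k-1}_ATA$ is the $(k-1)$-fold fibre product of $TA$ over $A$; it is also a vector bundle over $\oplus^{k-1}TM$ via $(Tq_A)^{k-1}$. $T^*A$ is a vector bundle over $A$ and also over $A^*$, via $r:T^*A\to A^*$, where $r(\gamma)$, for $\gamma\in T_u^*A$, is the restriction of $\gamma$ to vertical vectors $T_u(A_{q_A(u)})\cong A_{q_A(u)}$ (in coordinates $(x^j,u^d,p_j,\xi_d)$ on $T^*A$, $r$ maps to $(x^j,\xi_d)$, and $(u^d,p_j)$ are linear fibre coordinates). For $\Lambda\in\Omega^k(A)$ set $\Lambda^\sharp:\oplus^{k-1}_ATA\to T^*A$, $\Lambda^\sharp(U_1,\ldots,U_{k-1})=i_{U_{k-1}}\cdots i_{U_1}\Lambda$. $\Lambda$ is linear if $\Lambda^\sharp$ is a vector-bundle morphism from $\oplus^{k-1}_ATA\to\oplus^{k-1}TM$ to $r:T^*A\to A^*$; it then covers a base map $\lambda:\oplus^{k-1}TM\to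 A^*$, which is skew-symmetric and multilinear, hence is viewed as a vector-bundle map $\wedge^{k-1}TM\to A^*$ with transpose $\lambda^t:A\to\wedge^{k-1}T^*M$. For a vector-bundle map $\mu:A\to\wedge^lT^*M$ over the identity, $\Lambda_\mu\in\Omega^l(A)$ is defined by $(\Lambda_\mu)_u(U_1,\ldots,U_l)=\mu(u)(Tq_A(U_1),\ldots,Tq_A(U_l))$ for $U_i\in T_uA$. *)

(* Defs.v *)
(* Manifolds are real, C^oo, of a fixed finite dimension; vector bundles have
   constant finite rank. *)
From HB Require Import structures.
From mathcomp Require Import all_boot all_order all_algebra.
From mathcomp Require Import all_classical all_reals all_analysis.
Set Implicit Arguments.
Unset Strict Implicit.
Unset Printing Implicit Defensive.
Import Order.TTheory GRing.Theory Num.Theory.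
Import numFieldNormedType.Exports.
Local Open Scope classical_set_scope.
Local Open Scope ring_scope.

Section Smooth.
Context {R : realType} {V W : normedModType R}.

(* Only used on open sets [U]; differentiability is Frechet differentiability. *)
Fixpoint Ck_on (k : nat) (U : set V) (f : V -> W) : Prop :=
  if k is j.+1 then
    (forall x, U x -> differentiable f x) /\
    (forall v, Ck_on j U (fun x => 'D_v f x))
  else forall x, U x -> {for x, continuous f}.

Definition smooth_on (U : set V) (f : V -> W) : Prop :=
  forall k, Ck_on k U f.

End Smooth.

(* Charts on a set: [coord i] is meaningful on [dom i], and [param i] is its
   inverse on [coord i @` dom i]. The field [chart_at] selects a chart around
   each point. *)
Record atlas (R : realType) (N : nat) := Atlas {
  pt :> Type;
  chart : Type;
  dom : chart -> set pt;
  coord : chart -> pt -> 'rV[R]_N;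
  param : chart -> 'rV[R]_N -> pt;
  chart_at : pt -> chart }.

(* The topology induced by the atlas. *)
Definition mopen (R : realType) (N : nat) (X : atlas R N) (O : set X) : Prop :=
  forall i : chart X, open (coord i @` (dom i `&` O)).

Record is_manifold (R : realType) (N : nat) (X : atlas R N) : Prop := {
  coordK : forall (i : chart X) (x : X), dom i x -> param i (coord i x) = x;
  dom_chart_at : forall x : X, dom (chart_at x) x;
  dom_open : forall i : chart X, mopen (dom i);
  coord_smooth : forall i j : chart X,
    smooth_on (coord i @` (dom i `&` dom j)) (coord j \o param i);
  hausdorff : forall x y : X, x <> y ->
    exists O O' : set X,
      [/\ mopen O, mopen O', O x, O' y & O `&` O' = set0];
  second_countable : exists B : nat -> set X,
    (forall k, mopen (B k)) /\
    (forall (O : set X) (x : X), mopen O -> O x ->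
       exists k, B k x /\ B k `<=` O) }.

Record manifold (R : realType) (n : nat) := Manifold {
  manifold_atlas :> atlas R n;
  manifoldP : is_manifold manifold_atlas }.

Section Forms.
Context {R : realType} {N : nat} {X : atlas R N}.

(* The tangent space [T_x X] is 'rV[R]_N, a vector being represented by its
   components in the chart [chart_at x]. A vector tangent to [X] at
   [param i y] with components [w] in another chart [i] is thus represented
   by [dparam i y w]. *)
Definition dparam (i : chart X) (y w : 'rV[R]_N) : 'rV[R]_N :=
  'D_w (coord (chart_at (param i y)) \o param i) y.

Definition alt_multilinear (k : nat) (f : ('I_k -> 'rV[R]_N) -> R) : Prop :=
  (forall (v : 'I_k -> 'rV[R]_N) a c w w',
     f (dfwith v a (c *: w + w')) = c * f (dfwith v a w) + f (dfwith v a w')) /\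
  (forall (v : 'I_k -> 'rV[R]_N) a b, a != b -> v a = v b -> f v = 0).

Definition pform (k : nat) : Type := X -> ('I_k -> 'rV[R]_N) -> R.

(* The components of a form in an arbitrary chart [i]. *)
Definition local_rep (k : nat) (w : pform k) (i : chart X)
    (y : 'rV[R]_N) (v : 'I_k -> 'rV[R]_N) : R :=
  w (param i y) (fun a => dparam i y (v a)).

Definition is_form (k : nat) (w : pform k) : Prop :=
  (forall x, alt_multilinear (w x)) /\
  (forall (i : chart X) (v : 'I_k -> 'rV[R]_N),
     smooth_on (coord i @` dom i) (fun y => local_rep w i y v)).

(* The coordinate formula for the exterior derivative, at [x] in the chart
   [chart_at x]:
   dw(v_0, ..., v_k) = sum_a (-1)^a D_{v_a} (w(v_0, .., ^v_a, .., v_k)). *)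
Definition extd (k : nat) (w : pform k) : pform k.+1 := fun x v =>
  \sum_(a < k.+1) (-1) ^+ a *
    'D_(v a) (fun y => local_rep w (chart_at x) y (v \o lift a))
             (coord (chart_at x) x).

End Forms.
Arguments pform {R N} X k.

Definition tmap (R : realType) (m n : nat) (X : atlas R m) (Y : atlas R n)
    (f : X -> Y) (x : X) (v : 'rV[R]_m) : 'rV[R]_n :=
  'D_v (coord (chart_at (f x)) \o f \o param (chart_at x))
       (coord (chart_at x) x).

(* A smooth vector bundle of rank [r]: a family of vector spaces with local
   trivializations, linear on the fibres, whose transition functions are
   smooth. The linear bijection [triv j m] and its inverse [triv_inv j m] are
   only meaningful for [m] in [tdom j]. *)
Record vbundle (R : realType) (n : nat) (M : manifold R n) (r : nat) :=
    VBundle {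
  fiber :> M -> lmodType R;
  tidx : Type;
  tdom : tidx -> set M;
  triv : tidx -> forall m : M, {linear fiber m -> 'rV[R]_r};
  triv_inv : tidx -> forall m : M, 'rV[R]_r -> fiber m;
  triv_at : M -> tidx;
  tdom_triv_at : forall m, tdom (triv_at m) m;
  tdom_open : forall j, mopen (tdom j);
  trivK : forall j m, tdom j m -> cancel (triv j m) (triv_inv j m);
  triv_invK : forall j m, tdom j m -> cancel (triv_inv j m) (triv j m);
  triv_smooth : forall (j j' : tidx) (i : chart M) (e : 'rV[R]_r),
    smooth_on (coord i @` (dom i `&` (tdom j `&` tdom j')))
      (fun y => triv j' (param i y) (triv_inv j (param i y) e)) }.

Section Bundle.
Context {R : realType} {n r : nat} {M : manifold R n}.

Section Total.
Variable A : vbundle M r.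

(* The total space, with the charts (x, u) induced by a chart of the base and
   a local trivialization. *)
Definition total_space : atlas R (n + r) := {|
  pt := {m : M & A m};
  chart := (chart M * tidx A)%type;
  dom := fun ij => [set u | dom ij.1 (tag u) /\ tdom ij.2 (tag u)];
  coord := fun ij u =>
    row_mx (coord ij.1 (tag u)) (triv ij.2 (tag u) (tagged u));
  param := fun ij y =>
    existT (fun m : M => A m) (param ij.1 (lsubmx y))
      (triv_inv ij.2 (param ij.1 (lsubmx y)) (rsubmx y));
  chart_at := fun u => (chart_at (tag u), triv_at A (tag u)) |}.

Definition in_total (m : M) (e : A m) : total_space :=
  existT (fun m : M => A m) m e.

Definition proj : total_space -> M := fun u => tag u.

(* All points of a fibre of [A] have the same chart, so that a vector tangent
   to [A] at [in_total u] has components (dx, du) in which the vector bundle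
   structure of [TA] over [TM] has base coordinates (x, dx) and linear fibre
   coordinates (u, du). For [U] at [in_total u] and [U'] at [in_total u'] over
   the same vector of [TM], this is the combination c U + U', a vector at
   [in_total (c *: u + u')]. *)
Definition TA_lincomb (c : R) (U U' : 'rV[R]_(n + r)) : 'rV[R]_(n + r) :=
  row_mx (lsubmx U) (c *: rsubmx U + rsubmx U').

(* Similarly, a covector of [A] has components (p, xi), where (x, xi) are base
   coordinates and (u, p) are linear fibre coordinates of [T^*A] over [A^*].
   For [g] at [in_total u] and [g'] at [in_total u'] with the same image in
   [A^*], this is c g + g', a covector at [in_total (c *: u + u')]. *)
Definition cotA_lincomb (c : R) (g g' : 'rV[R]_(n + r) -> R) :
    'rV[R]_(n + r) -> R := fun W =>
  (c * g (row_mx (lsubmx W) 0) + g' (row_mx (lsubmx W) 0))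
  + g' (row_mx 0 (rsubmx W)).

(* The identification of [A m] with the vertical vectors at a point over [m]. *)
Definition vertical (m : M) (e : A m) : 'rV[R]_(n + r) :=
  row_mx 0 (triv (triv_at A m) m e).

(* The projection r : T^*A -> A^*. *)
Definition cot_proj (m : M) (g : 'rV[R]_(n + r) -> R) : A m -> R :=
  fun e => g (vertical e).

Definition sharp (l : nat) (L : pform total_space l.+1) (u : total_space)
    (U : 'I_l -> 'rV[R]_(n + r)) : 'rV[R]_(n + r) -> R := fun W =>
  L u (fun a => oapp U W (unlift ord_max a)).

(* [L] is linear, covering [lam]. *)
Definition linear_form_over (l : nat) (L : pform total_space l.+1)
    (lam : forall m : M, ('I_l -> 'rV[R]_n) -> {linear A m -> R^o}) : Prop :=
  [/\ is_form L,
      forall (m : M) (u : A m) (U : 'I_l -> 'rV[R]_(n + r)),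
        cot_proj (sharp L (in_total u) U)
        = lam m (fun a => tmap proj (in_total u) (U a)) :> (A m -> R) &
      forall (m : M) (u u' : A m) (U U' : 'I_l -> 'rV[R]_(n + r)) (c : R),
        (forall a, tmap proj (in_total u) (U a)
                   = tmap proj (in_total u') (U' a)) ->
        sharp L (in_total (c *: u + u')) (fun a => TA_lincomb c (U a) (U' a))
        = cotA_lincomb c (sharp L (in_total u) U) (sharp L (in_total u') U')].

Definition linear_form (l : nat) (L : pform total_space l.+1) : Prop :=
  exists lam, linear_form_over L lam.

(* Vector bundle morphisms A -> wedge^l T^*M over the identity of M; smoothness
   is that of the components of [mu] in the local frames of [A] and [TM]. *)
Definition fiber_map (l : nat) : Type :=
  forall m : M, A m -> ('I_l -> 'rV[R]_n) -> R.

Definition vb_morphism (l : nat) (mu : fiber_map l) : Prop :=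
  [/\ forall m (e : A m), alt_multilinear (mu m e),
      forall m (c : R) (e e' : A m) (v : 'I_l -> 'rV[R]_n),
        mu m (c *: e + e') v = c * mu m e v + mu m e' v &
      forall (i : chart M) (j : tidx A) (e : 'rV[R]_r) (v : 'I_l -> 'rV[R]_n),
        smooth_on (coord i @` (dom i `&` tdom j))
          (fun y => mu (param i y) (triv_inv j (param i y) e)
                      (fun a => dparam i y (v a)) : R)].

(* Lambda_mu *)
Definition Lam (l : nat) (mu : fiber_map l) : pform total_space l := fun u U =>
  mu (tag u) (tagged u) (fun a => tmap proj u (U a)).

Definition form_of (l : nat) (mu : fiber_map l) (nu : fiber_map l.+1) :
    pform total_space l.+1 :=
  fun u U => extd (Lam mu) u U + Lam nu u U.

End Total.
End Bundle.

(* Main.v *)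
(* Over a point of [M], [d Lambda_mu] is a sum of two terms: one involves only
   the base derivatives of [mu] and the projections to [TM] of its arguments, the
   other is, up to sign, [mu] evaluated on the vertical component of one argument
   and on the projections of the remaining ones. Hence [d Lambda_mu] is linear and
   covers [(-1)^l mu^t], while [Lambda_nu] is linear and covers [0]; as the map
   covered by a form is unique, [mu], and then [nu], is determined by
   [d Lambda_mu + Lambda_nu]. Conversely, if [L] is linear and covers [lam], then
   [mu := (-1)^l lam^t] is a bundle morphism and [L - d Lambda_mu] is linear and
   covers [0], so that it vanishes as soon as one argument is vertical and hence
   is of the form [Lambda_nu].
   Since [extd] is computed in a chart chosen at each point, the smoothness of
   [d Lambda_mu] requires the coordinate formula for [d] to be invariant under
   changes of charts, which rests on the symmetry of second derivatives. *)
From HB Require Import structures.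
Require Import Defs.
From mathcomp Require Import all_boot all_order all_algebra perm.
From mathcomp Require Import all_classical all_reals all_analysis.
From mathcomp Require Import zify.
(* [coord] is also defined in mathcomp's vector.v. *)
Import Defs.
Set Implicit Arguments.
Unset Strict Implicit.
Unset Printing Implicit Defensive.
Import Order.TTheory GRing.Theory Num.Theory.
Import numFieldNormedType.Exports.
Local Open Scope classical_set_scope.
Local Open Scope ring_scope.

(** * Alternating multilinear functions *)

Section DfWith.
Context {I : eqType} {T : Type}.
Implicit Types (v : I -> T) (i j : I).

Lemma dfwithE v i w j : dfwith v i w j = if j == i then w else v j.
Proof.
by case: dfwithP => [|j' ij]; [rewrite eqxx | rewrite eq_sym (negPf ij)].
Qed.

Lemma dfwith_id v i : dfwith v i (v i) = v.
Proof. by apply/funext => j; rewrite dfwithE; have [->|] := eqVneq j i. Qed.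

Lemma dfwith_dfwith v i w w' : dfwith (dfwith v i w) i w' = dfwith v i w'.
Proof. by apply/funext => j; rewrite !dfwithE; have [] := eqVneq j i. Qed.

Lemma dfwithC v i j w w' : i != j ->
  dfwith (dfwith v i w) j w' = dfwith (dfwith v j w') i w.
Proof.
move=> ij; apply/funext => h; rewrite !dfwithE.
by have [->|//] := eqVneq h j; rewrite eq_sym (negPf ij).
Qed.

End DfWith.

Lemma comp_dfwith (I : eqType) (T T' : Type) (g : T -> T')
    (v : I -> T) (i : I) (w : T) :
  (fun j => g (dfwith v i w j)) = dfwith (fun j => g (v j)) i (g w).
Proof. by apply/funext => j /=; rewrite !dfwithE; have [] := eqVneq j i. Qed.

Section DfWithLift.
Context {k : nat} {T : Type}.
Implicit Type v : 'I_k.+1 -> T.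

Lemma dfwith_lift_eq v a w : dfwith v a w \o lift a = v \o lift a.
Proof.
by apply/funext => j; rewrite /= dfwithE eq_sym (negPf (neq_lift _ _)).
Qed.

Lemma dfwith_lift v a b w :
  dfwith v (lift a b) w \o lift a = dfwith (v \o lift a) b w.
Proof.
by apply/funext => j; rewrite /= !dfwithE (inj_eq (@lift_inj _ a)).
Qed.

End DfWithLift.

Section Multilinear.
Context {R : realType} {N k : nat}.

Definition multilinear (f : ('I_k -> 'rV[R]_N) -> R) :=
  forall (v : 'I_k -> 'rV[R]_N) a c w w',
    f (dfwith v a (c *: w + w')) = c * f (dfwith v a w) + f (dfwith v a w').

Variables (f : ('I_k -> 'rV[R]_N) -> R) (fM : multilinear f).
Implicit Type v : 'I_k -> 'rV[R]_N.

Lemma multilinear0 v a : f (dfwith v a 0) = 0.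
Proof.
have := fM v a 1 0 0; rewrite scaler0 addr0 mul1r => /eqP.
by rewrite -subr_eq0 opprD addNKr oppr_eq0 => /eqP.
Qed.

Lemma multilinear_eq0 v a : v a = 0 -> f v = 0.
Proof. by move=> va0; rewrite -(dfwith_id v a) va0 multilinear0. Qed.

Lemma multilinearD v a w w' :
  f (dfwith v a (w + w')) = f (dfwith v a w) + f (dfwith v a w').
Proof. by rewrite -[w]scale1r fM scale1r mul1r. Qed.

Lemma multilinear_sum v a (I : Type) (s : seq I) (c : I -> R) w :
  f (dfwith v a (\sum_(j <- s) c j *: w j)) =
  \sum_(j <- s) c j * f (dfwith v a (w j)).
Proof.
elim: s => [|j s IHs]; first by rewrite !big_nil multilinear0.
by rewrite !big_cons fM IHs.
Qed.

End Multilinear.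

Section Alternating.
Context {R : realType} {N : nat}.

(** Polarization: put [v a + v b] in both slots [a] and [b] and expand. The value and its two
    diagonal terms vanish, which leaves [f v] plus the swapped value. *)
Lemma alt_swap k (f : ('I_k -> 'rV[R]_N) -> R) (fA : alt_multilinear f) v a b :
  a != b -> f (v \o tperm a b) = - f v.
Proof.
move: fA => [fM fA] ab; pose g x y := f (dfwith (dfwith v a x) b y).
have gD1 x x' y : g (x + x') y = g x y + g x' y.
  by rewrite /g !(dfwithC _ _ _ ab) multilinearD.
have gxx x : g x x = 0.
  apply: (fA _ a b ab); rewrite !dfwithE eqxx (negPf ab) ifT //.
have gD2 x y y' : g x (y + y') = g x y + g x y' by rewrite /g multilinearD.
have gv : g (v a) (v b) = f v by rewrite /g !dfwith_id.
have gv' : g (v b) (v a) = f (v \o tperm a b).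
  congr f; apply/funext => j; rewrite /= !dfwithE.
  case: tpermP => [->|->|/eqP ja /eqP jb]; rewrite ?(negPf ab) ?eqxx //.
  by rewrite (negPf ja) (negPf jb).
have := gxx (v a + v b); rewrite gD1 !gD2 !gxx gv gv' addr0 add0r => /eqP.
by rewrite addrC addr_eq0 => /eqP.
Qed.

(* The statement is proved by induction on [q - p]: transposing the entries of
   [v] at [p] and [p.+1] moves [p] one step towards [q]. *)
Lemma alt_lift_lt k (f : ('I_k -> 'rV[R]_N) -> R) (fA : alt_multilinear f)
    (v : 'I_k.+1 -> 'rV[R]_N) (p q : 'I_k.+1) :
  (p < q)%N -> v p = v q ->
  (-1) ^+ p * f (v \o lift p) + (-1) ^+ q * f (v \o lift q) = 0.
Proof.
have [d] := ubnP (q - p)%N; elim: d v p q => // d IHd v p q qpd pq vpq.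
have p1k : (p.+1 < k.+1)%N by apply: leq_ltn_trans pq _.
pose p1 := Ordinal p1k.
have [qp1|qp1] := eqVneq q p1.
  rewrite qp1 /= exprS mulN1r mulNr.
  (* Omitting [p] and omitting [p1] differ only at index [p], where the two liftings pick [q] and
     [p], on which [v] agrees. *)
  suff -> : v \o lift p = v \o lift p1 by rewrite subrr.
  apply/funext => j /=; rewrite -qp1.
  have [jp|jp] := eqVneq (j : nat) p.
    have -> : lift p j = q.
      by apply/val_inj; rewrite qp1 /= /bump jp leqnn.
    have -> : lift q j = p.
      by apply/val_inj; rewrite qp1 /= /bump jp ltnn.
    by [].
  congr v; apply/val_inj; rewrite /= /bump qp1 /=.
  by rewrite [in LHS]leq_eqVlt eq_sym (negPf jp).
have p1q : (p1 < q)%N by rewrite ltn_neqAle eq_sym qp1.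
have pk : (p < k)%N by rewrite -ltnS.
have p2k : (p.+1 < k)%N by rewrite -ltnS (leq_ltn_trans p1q).
pose i0 : 'I_k := Ordinal pk; pose i1 : 'I_k := Ordinal p2k.
have i01 : i0 != i1 by rewrite -val_eqE /= neq_ltn ltnSn.
pose v' := v \o tperm p p1.
have pp1 : p != p1 by rewrite -val_eqE /= neq_ltn ltnSn.
have qp : p != q by rewrite -val_eqE neq_ltn pq.
have := IHd v' p1 q _ p1q.
rewrite /v' /= tpermR tpermD; [|by []|by rewrite eq_sym].
move=> IH; have {IH} := IH _ vpq.
have -> : (v \o tperm p p1) \o lift p1 = v \o lift p.
  apply/funext => j /=; case: tpermP => [jp|jp|/eqP jp /eqP jp1].
  - by congr v; apply/val_inj; move/(congr1 val): jp; rewrite /= /bump; lia.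
  - by move: (neq_lift p1 j); rewrite jp eqxx.
  by congr v; apply/val_inj; move: jp jp1; rewrite -!val_eqE /= /bump; lia.
have -> : (v \o tperm p p1) \o lift q = (v \o lift q) \o tperm i0 i1.
  have li0 : lift q i0 = p by apply/val_inj; rewrite /= /bump leqNgt pq.
  have li1 : lift q i1 = p1 by apply/val_inj; rewrite /= /bump leqNgt p1q.
  apply/funext => j /=; case: (tpermP i0) => [->|->|/eqP j0 /eqP j1].
  - by rewrite li0 tpermL li1.
  - by rewrite li1 tpermR li0.
  by rewrite tpermD // -?li0 -?li1 (inj_eq (@lift_inj _ q)) eq_sym.
(* Both terms of the induction hypothesis have the opposite sign: the first by the exponent [p.+1],
   the second by the swap of [i0] and [i1]. *)
rewrite alt_swap //= exprS mulN1r mulNr mulrN -opprD => IH.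
apply/eqP; rewrite -oppr_eq0; apply/eqP/IH.
by rewrite ltnS in qpd; apply: leq_trans qpd; rewrite ltn_sub2l.
Qed.

(** This cancellation serves twice: for the second-derivative terms in [alt_lift_sym_sum], and for
    the alternation of the exterior derivative in [loc_extd_alt]. *)
Lemma alt_lift k (f : ('I_k -> 'rV[R]_N) -> R) (fA : alt_multilinear f)
    (v : 'I_k.+1 -> 'rV[R]_N) (p q : 'I_k.+1) :
  p != q -> v p = v q ->
  (-1) ^+ p * f (v \o lift p) + (-1) ^+ q * f (v \o lift q) = 0.
Proof.
rewrite -val_eqE neq_ltn => /orP[pq|qp] vpq; first exact: alt_lift_lt.
by rewrite addrC alt_lift_lt.
Qed.

(* The terms [(a, lift a b)] and [(lift a b, a)] cancel pairwise. *)
Lemma alt_lift_sym_sum k (f : ('I_k -> 'rV[R]_N) -> R)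
    (fA : alt_multilinear f) (v : 'I_k.+1 -> 'rV[R]_N)
    (S : 'I_k.+1 -> 'I_k.+1 -> 'rV[R]_N) :
  (forall a b, S a b = S b a) ->
  \sum_(a < k.+1) (-1) ^+ a *
    \sum_(b < k) f (dfwith (v \o lift a) b (S a (lift a b))) = 0.
Proof.
move=> Ssym.
pose T (a c : 'I_k.+1) := (-1) ^+ a * f (dfwith v c (S a c) \o lift a).
have TN a c : a != c -> T a c = - T c a.
  move=> ac; apply/eqP; rewrite -addr_eq0; apply/eqP.
  (* [v'] carries the same vector [S a c] at [a] and at [c]: omitting [a] gives the arguments of
     [T a c], omitting [c] those of [T c a]. *)
  pose v' := dfwith (dfwith v c (S a c)) a (S a c).
  have v'a : v' a = S a c by rewrite /v' dfwithE eqxx.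
  have v'c : v' c = S a c by rewrite /v' !dfwithE eqxx; case: eqP.
  have := alt_lift fA ac (etrans v'a (esym v'c)).
  rewrite /v' dfwith_lift_eq dfwithC 1?eq_sym // dfwith_lift_eq.
  by rewrite /T (Ssym c a).
(* Reindexing by [c = lift a b] gives a sum over ordered pairs [c != a], on which [T] is
   antisymmetric. *)
have -> : \sum_(a < k.+1) (-1) ^+ a *
    \sum_(b < k) f (dfwith (v \o lift a) b (S a (lift a b))) =
  \sum_(a < k.+1) \sum_(c < k.+1 | c != a) T a c.
  apply: eq_bigr => a _; rewrite mulr_sumr.
  rewrite [RHS]big_mkcond (bigD1_ord a) //= eqxx add0r.
  by apply: eq_bigr => b _; rewrite eq_sym neq_lift /T dfwith_lift.
set s := (X in X = 0); have sN : s = - s.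
  rewrite {1}/s (exchange_big_dep predT) //= -sumrN; apply: eq_bigr => a _.
  rewrite -sumrN; apply: eq_big => c; first by rewrite eq_sym.
  by move=> ca; rewrite TN 1?eq_sym.
have : s *+ 2 = 0 by rewrite mulr2n {1}sN addNr.
by move/eqP; rewrite mulrn_eq0 => /eqP.
Qed.

End Alternating.

(** * Smooth functions *)

Lemma open_near (T : topologicalType) (U : set T) x (P : T -> Prop) :
  open U -> U x -> (forall y, U y -> P y) -> \forall y \near x, P y.
Proof. by move=> oU Ux UP; apply: filterS UP _; apply: open_nbhs_nbhs. Qed.

Section Differentiability.
Context {R : realType} {V W : normedModType R}.
Implicit Types (f g : V -> W) (U : set V).

(** The first-order expansion of [f] at [x] is also one of [g], and uniqueness of the differential
    identifies its linear part with ['d g x]. *)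
Lemma near_eq_differentiable f g x :
  (\forall y \near x, f y = g y) -> differentiable f x -> differentiable g x.
Proof.
move=> fg df.
have gE : g \o shift x = cst (g x) + 'd f x +o_ 0 id.
  apply/eqaddoP => e e0; move/diff_locally/eqaddoP: df => /(_ e e0).
  have fg0 : \forall y \near 0, f (y + x) = g (y + x).
    by have := fg; rewrite (near_shift 0) subr0.
  apply: filterS2 fg0 => y /= fgy.
  by rewrite !fctE /= fgy (nbhs_singleton fg).
have dC : continuous ('d f x) by exact: diff_continuous.
by apply/diff_locallyP; rewrite (diff_unique dC gE).
Qed.

Lemma open_derive_eq U f g x v : open U -> U x ->
  (forall y, U y -> f y = g y) -> 'D_v f x = 'D_v g x.
Proof. by move=> oU Ux fg; apply: near_eq_derive; apply: open_near fg. Qed.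

Lemma open_differentiable_eq U f g x : open U -> U x ->
  (forall y, U y -> f y = g y) -> differentiable f x -> differentiable g x.
Proof.
by move=> oU Ux fg; apply: near_eq_differentiable; apply: open_near fg.
Qed.

Lemma derive_linear f x c v w : differentiable f x ->
  'D_(c *: v + w) f x = c *: 'D_v f x + 'D_w f x.
Proof. by move=> df; rewrite !deriveE // linearP. Qed.

End Differentiability.

Section DeriveComp.
Context {R : realType}.

Lemma derive_comp (V W Z : normedModType R) (f : V -> W) (g : W -> Z) x v :
  differentiable f x -> differentiable g (f x) ->
  'D_v (g \o f) x = 'D_('D_v f x) g (f x).
Proof.
move=> df dg; rewrite !deriveE //; last exact: differentiable_comp.
by rewrite diff_comp.
Qed.

(* Finite-dimensionality of the domain makes [L] continuous. *)
Lemma linear_row_continuous (W : normedModType R) N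
    (L : {linear 'rV[R]_N -> W}) : continuous L.
Proof.
move=> x; have -> : (L : _ -> W) = fun y => \sum_(j < N) y 0 j *: L (delta_mx 0 j).
  apply/funext => y; rewrite {1}[y]row_sum_delta linear_sum.
  by apply: eq_bigr => j _; rewrite linearZ.
suff LC (s : seq 'I_N) : {for x, continuous
    (fun y : 'rV[R]_N => \sum_(j <- s) y 0 j *: L (delta_mx 0 j))} by exact: LC.
elim: s => [|j s IHs].
  rewrite (_ : (fun _ => _) = cst 0); first exact: cst_continuous.
  by apply/funext => y; rewrite big_nil.
rewrite (_ : (fun _ => _) = (fun y : 'rV[R]_N => y 0 j *: L (delta_mx 0 j)) +
    (fun y : 'rV[R]_N => \sum_(i <- s) y 0 i *: L (delta_mx 0 i))).
  apply: continuousD => //; apply: continuousZr_tmp; exact: coord_continuous.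
by apply/funext => y; rewrite big_cons.
Qed.

Lemma differentiable_linear_row (W : normedModType R) N
    (L : {linear 'rV[R]_N -> W}) x : differentiable L x.
Proof. exact/linear_differentiable/linear_row_continuous. Qed.

Lemma derive_linear_row (W : normedModType R) N
    (L : {linear 'rV[R]_N -> W}) x v : 'D_v L x = L v.
Proof.
rewrite deriveE ?diff_lin //; last exact: differentiable_linear_row.
exact: linear_row_continuous.
Qed.

End DeriveComp.

Section Smooth.
Context {R : realType}.
Implicit Types (V W Z : normedModType R) (k : nat).

(** This allows rewriting by identities valid only on [U], such as local formulas in a chart;
    openness lets them pass to derivatives. *)
Lemma Ck_on_eq V W k (U : set V) (f g : V -> W) : open U ->
  (forall x, U x -> f x = g x) -> Ck_on k U f -> Ck_on k U g.
Proof.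
move=> oU; elim: k f g => [|k IHk] f g fg /=.
  move=> fC x Ux.
  suff : g @ x --> f x by rewrite fg.
  apply: cvg_trans (fC x Ux).
  by apply: near_eq_cvg; apply: open_near fg.
move=> [df Df]; split=> [x Ux|v].
  by apply: (open_differentiable_eq oU Ux fg); apply: df.
apply: IHk (Df v) => x Ux; exact: open_derive_eq fg.
Qed.

Lemma Ck_on_subset V W k (U U' : set V) (f : V -> W) :
  U' `<=` U -> Ck_on k U f -> Ck_on k U' f.
Proof.
move=> UU'; elim: k f => [|k IHk] f /=; first by move=> fC x /UU'/fC.
by move=> [df Df]; split=> [x /UU'/df //|v]; apply: IHk.
Qed.

Lemma Ck_on_le V W k (U : set V) (f : V -> W) : Ck_on k.+1 U f -> Ck_on k U f.
Proof.
elim: k f => [|k IHk] f [df Df].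
  by move=> x Ux; apply/differentiable_continuous/df.
by split=> // v; apply/IHk/Df.
Qed.

Lemma Ck_on_cst V W k (U : set V) (w : W) : Ck_on k U (cst w).
Proof.
elim: k w => [|k IHk] w /=; first by move=> x _; exact: cvg_cst.
split=> [x _|v]; first exact: differentiable_cst.
rewrite (_ : (fun x => _) = cst 0) //.
by apply/funext => x; rewrite derive_cst.
Qed.

Lemma Ck_onD V W k (U : set V) (f g : V -> W) : open U ->
  Ck_on k U f -> Ck_on k U g -> Ck_on k U (fun x => f x + g x).
Proof.
move=> oU; elim: k f g => [|k IHk] f g /=.
  by move=> fC gC x Ux; apply: cvgD; [apply: fC|apply: gC].
move=> [df Df] [dg Dg]; split=> [x Ux|v].
  by apply: differentiableD; [apply: df|apply: dg].
apply: (Ck_on_eq oU _ (IHk _ _ (Df v) (Dg v))) => x Ux.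
by rewrite deriveD //; apply: diff_derivable; [apply: df|apply: dg].
Qed.

Lemma Ck_on_linear V W Z k (U : set V) (f : V -> W) (L : {linear W -> Z}) :
  open U -> continuous L -> Ck_on k U f -> Ck_on k U (fun x => L (f x)).
Proof.
move=> oU LC; elim: k f => [|k IHk] f /=.
  by move=> fC x Ux; apply: continuous_comp; [apply: fC|apply: LC].
move=> [df Df]; split=> [x Ux|v].
  by apply: differentiable_comp; [apply: df|apply: linear_differentiable].
apply: (Ck_on_eq oU _ (IHk _ (Df v))) => x Ux.
rewrite (@derive_comp _ _ _ _ f L) ?deriveE ?diff_lin //;
  by [apply: df|apply: linear_differentiable].
Qed.

Lemma Ck_onM V k (U : set V) (f g : V -> R) : open U ->
  Ck_on k U f -> Ck_on k U g -> Ck_on k U (fun x => f x * g x).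
Proof.
move=> oU; elim: k f g => [|k IHk] f g.
  by move=> fC gC x Ux; apply: cvgM; [apply: fC|apply: gC].
move=> fC gC; have [df Df] := fC; have [dg Dg] := gC.
split=> [x Ux|v].
  by apply: differentiableM; [apply: df|apply: dg].
have DC := Ck_onD oU (IHk _ _ (Ck_on_le fC) (Dg v)) (IHk _ _ (Ck_on_le gC) (Df v)).
apply: Ck_on_eq oU _ DC => x Ux.
by rewrite deriveM //; apply: diff_derivable; [apply: df|apply: dg].
Qed.

Lemma Ck_on_sum V W k (U : set V) (I : Type) (s : seq I) (f : I -> V -> W) :
  open U -> (forall i, Ck_on k U (f i)) ->
  Ck_on k U (fun x => \sum_(i <- s) f i x).
Proof.
move=> oU fC; elim: s => [|i s IHs].
  by under eq_fun do rewrite big_nil; exact: Ck_on_cst.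
by under eq_fun do rewrite big_cons; exact: Ck_onD.
Qed.

Lemma Ck_on_linear_row V W k N (U : set V) (f : V -> 'rV[R]_N)
    (L : {linear 'rV[R]_N -> W}) :
  open U -> Ck_on k U f -> Ck_on k U (fun x => L (f x)).
Proof. by move=> oU; apply: Ck_on_linear => //; exact: linear_row_continuous. Qed.

Lemma Ck_on_coord V k N (U : set V) (f : V -> 'rV[R]_N) j :
  open U -> Ck_on k U f -> Ck_on k U (fun x => f x 0 j).
Proof.
move=> oU fC.
have lin : linear (fun y : 'rV[R]_N => y 0 j : R^o) by move=> c y z; rewrite !mxE.
pose L : {linear 'rV[R]_N -> R^o} :=
  HB.pack (fun y : 'rV[R]_N => y 0 j : R^o) (GRing.isLinear.Build _ _ _ _ _ lin).
exact: (@Ck_on_linear_row V R^o k N U f L).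
Qed.

Lemma Ck_on_row V k N (U : set V) (f : V -> 'rV[R]_N) :
  open U -> (forall j, Ck_on k U (fun x => f x 0 j)) -> Ck_on k U f.
Proof.
move=> oU fC.
pose g j x := f x 0 j *: (delta_mx 0 j : 'rV[R]_N).
have gC j : Ck_on k U (g j).
  have lin : linear (fun c : R^o => c *: (delta_mx 0 j : 'rV[R]_N)).
    by move=> c y z; rewrite scalerDl scalerA.
  pose L : {linear R^o -> 'rV[R]_N} :=
    HB.pack (fun c : R^o => c *: (delta_mx 0 j : 'rV[R]_N))
      (GRing.isLinear.Build _ _ _ _ _ lin).
  by apply: (@Ck_on_linear V R^o _ k U _ L) => //; exact: scalel_continuous.
have := Ck_on_sum (index_enum _) oU gC.
by apply: Ck_on_eq oU _ => x Ux; rewrite [RHS]row_sum_delta.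
Qed.

(** In the chain rule the direction ['D_v f x] varies with [x], whereas [Ck_on] speaks of fixed
    directions. Expanding it in the standard basis gives a sum of products of components of ['D_v f]
    with partial derivatives of [g] along [f], to which the induction applies. *)
Lemma Ck_on_comp_real V k N (U : set V) (U' : set 'rV[R]_N)
    (f : V -> 'rV[R]_N) (g : 'rV[R]_N -> R) : open U ->
  (forall x, U x -> U' (f x)) ->
  Ck_on k U f -> Ck_on k U' g -> Ck_on k U (g \o f).
Proof.
move=> oU fU; elim: k g => [|k IHk] g.
  by move=> fC gC x Ux; apply: continuous_comp; [apply: fC|apply/gC/fU].
move=> fC gC; have [df Df] := fC; have [dg Dg] := gC.
split=> [x Ux|v].
  by apply: differentiable_comp; [apply: df|apply/dg/fU].
have DC : Ck_on k U (fun x =>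
    \sum_(j < N) 'D_v f x 0 j * 'D_(delta_mx 0 j) g (f x)).
  apply: Ck_on_sum => // j; apply: Ck_onM => //; first exact: Ck_on_coord (Df v).
  by apply: IHk (Dg _); exact: Ck_on_le fC.
apply: Ck_on_eq oU _ DC => x Ux.
have dgfx : differentiable g (f x) by exact/dg/fU.
rewrite (derive_comp _ (df x Ux) dgfx).
rewrite (deriveE _ dgfx) [in RHS](row_sum_delta ('D_v f x)) linear_sum.
by apply: eq_bigr => j _; rewrite linearZ /= (deriveE _ dgfx).
Qed.

End Smooth.

Section SmoothOn.
Context {R : realType}.
Implicit Types (V W : normedModType R).

Lemma smooth_on_eq V W (U : set V) (f g : V -> W) : open U ->
  (forall x, U x -> f x = g x) -> smooth_on U f -> smooth_on U g.
Proof. by move=> oU fg fC k; exact: Ck_on_eq fg (fC k). Qed.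

Lemma smooth_on_subset V W (U U' : set V) (f : V -> W) :
  U' `<=` U -> smooth_on U f -> smooth_on U' f.
Proof. by move=> UU' fC k; exact: Ck_on_subset (fC k). Qed.

Lemma smooth_on_cst V W (U : set V) (w : W) : smooth_on U (fun=> w).
Proof. by move=> k; exact: Ck_on_cst. Qed.

Lemma smooth_onD V W (U : set V) (f g : V -> W) : open U ->
  smooth_on U f -> smooth_on U g -> smooth_on U (fun x => f x + g x).
Proof. by move=> oU fC gC k; exact: Ck_onD. Qed.

Lemma smooth_onM V (U : set V) (f g : V -> R) : open U ->
  smooth_on U f -> smooth_on U g -> smooth_on U (fun x => f x * g x).
Proof. by move=> oU fC gC k; exact: Ck_onM. Qed.

Lemma smooth_on_sum V W (U : set V) (I : Type) (s : seq I) (f : I -> V -> W) :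
  open U -> (forall i, smooth_on U (f i)) ->
  smooth_on U (fun x => \sum_(i <- s) f i x).
Proof. by move=> oU fC k; apply: Ck_on_sum => // i; exact: fC. Qed.

Lemma smooth_on_coord V N (U : set V) (f : V -> 'rV[R]_N) j :
  open U -> smooth_on U f -> smooth_on U (fun x => f x 0 j).
Proof. by move=> oU fC k; exact: Ck_on_coord. Qed.

Lemma smooth_on_row V N (U : set V) (f : V -> 'rV[R]_N) :
  open U -> (forall j, smooth_on U (fun x => f x 0 j)) -> smooth_on U f.
Proof. by move=> oU fC k; apply: Ck_on_row => // j; exact: fC. Qed.

Lemma smooth_on_linear V W N (U : set V) (f : V -> 'rV[R]_N)
    (L : {linear 'rV[R]_N -> W}) :
  open U -> smooth_on U f -> smooth_on U (fun x => L (f x)).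
Proof. by move=> oU fC k; exact: Ck_on_linear_row. Qed.

Lemma smooth_on_comp V N (U : set V) (U' : set 'rV[R]_N)
    (f : V -> 'rV[R]_N) (g : 'rV[R]_N -> R) : open U ->
  (forall x, U x -> U' (f x)) ->
  smooth_on U f -> smooth_on U' g -> smooth_on U (g \o f).
Proof. by move=> oU fU fC gC k; exact: Ck_on_comp_real fU (fC k) (gC k). Qed.

Lemma smooth_on_id V (U : set V) : smooth_on U (id : V -> V).
Proof.
move=> [|k] /=; first by move=> x _; exact: cvg_id.
split=> [x _|v]; first exact: ex_diff.
rewrite (_ : (fun x => _) = cst v); first exact: Ck_on_cst.
by apply/funext => x; rewrite derive_id.
Qed.

Lemma smooth_on_derive V W (U : set V) (f : V -> W) v :
  smooth_on U f -> smooth_on U (fun x => 'D_v f x).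
Proof. by move=> fC k; have [_] := fC k.+1; apply. Qed.

Lemma smooth_on_differentiable V W (U : set V) (f : V -> W) x :
  smooth_on U f -> U x -> differentiable f x.
Proof. by move=> fC; have [+ _] := fC 1%N; apply. Qed.

End SmoothOn.

(** * Symmetry of second derivatives *)

Section Schwarz.
Context {R : realType} {V : normedModType R}.
Implicit Types (f g : V -> R) (p x v w : V).

Lemma is_derive_line g p v (s : R) : differentiable g (p + s *: v) ->
  is_derive s 1 (fun t : R => g (p + t *: v)) ('D_v g (p + s *: v)).
Proof.
move=> dg; pose l (t : R) := p + t *: v.
have dl : is_diff s l (0 + *:%R ^~ v) by exact: is_diffD.
have dgl : differentiable (g \o l) s by apply: differentiable_comp.
apply: DeriveDef; first exact: diff_derivable.
rewrite (@derive_comp _ _ _ _ l g) //.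
by congr ('D__ g _); rewrite deriveE // diff_val /= fctE add0r scale1r.
Qed.

Lemma mvt_line g p v (h : R) : 0 < h ->
  (forall s, 0 <= s <= h -> differentiable g (p + s *: v)) ->
  exists2 s, 0 <= s <= h & g (p + h *: v) - g p = 'D_v g (p + s *: v) * h.
Proof.
move=> h0 dg; pose F (t : R) := g (p + t *: v).
have dF s : 0 <= s <= h -> is_derive s 1 F ('D_v g (p + s *: v)).
  by move=> /dg; exact: is_derive_line.
have [s| |c] := @MVT R F (fun s => 'D_v g (p + s *: v)) 0 h h0.
- by rewrite in_itv /= => /andP[s0 sh]; apply: dF; rewrite !ltW.
- apply: derivable_within_continuous => s.
  by rewrite in_itv /= => sI; have [] := dF s sI.
rewrite in_itv /= /F scale0r addr0 subr0 => /andP[c0 ch] Fc.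
by exists c => //; rewrite !ltW.
Qed.

(** The mean value theorem is applied twice: along [v] to the increment [f (y + h *: w) - f y], then
    along [w] to ['D_v f]. *)
Lemma second_difference (U : set V) f x v w (h : R) : 0 < h ->
  Ck_on 2 U f ->
  (forall s t, 0 <= s <= h -> 0 <= t <= h -> U (x + s *: v + t *: w)) ->
  exists s t, [/\ 0 <= s <= h, 0 <= t <= h &
    f (x + h *: v + h *: w) - f (x + h *: v) - (f (x + h *: w) - f x) =
    'D_w (fun y => 'D_v f y) (x + s *: v + t *: w) * h * h].
Proof.
move=> h0 [df Df] hU.
have hh : 0 <= h <= h by rewrite lexx ltW.
have z0 : 0 <= (0 : R) <= h by rewrite lexx ltW.
pose g y := f (y + h *: w) - f y.
have dsh y : is_diff y (fun y => y + h *: w) (id + 0) by exact: is_diffD.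
have dfs s : 0 <= s <= h -> differentiable f (x + s *: v).
  by move=> sI; apply: df; have := hU s 0 sI z0; rewrite scale0r addr0.
have dfsh s : 0 <= s <= h -> differentiable f (x + s *: v + h *: w).
  by move=> sI; apply: df; exact: hU.
have dfsh' s : 0 <= s <= h ->
    differentiable (fun y => f (y + h *: w)) (x + s *: v).
  move=> sI; apply: (@differentiable_comp _ _ _ _ (fun y => y + h *: w) f) => //.
  exact: dfsh.
have [|s sI] := @mvt_line g x v h h0.
  by move=> s sI; apply: differentiableB; [exact: dfsh'|exact: dfs].
rewrite {1 2}/g => gE.
have {gE} gE : f (x + h *: v + h *: w) - f (x + h *: v) - (f (x + h *: w) - f x) =
    ('D_v f (x + s *: v + h *: w) - 'D_v f (x + s *: v)) * h.
  rewrite gE; congr (_ * _).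
  rewrite /g deriveB; [|exact: diff_derivable (dfsh' _ sI)
                       |exact: diff_derivable (dfs _ sI)].
  congr (_ - _).
  rewrite (@derive_comp _ _ _ _ (fun y => y + h *: w) f) //; last exact: dfsh.
  by congr ('D__ f _); rewrite deriveE // diff_val /= fctE /= addr0.
have [dDf _] := Df v.
have [|t tI DE] := @mvt_line (fun y => 'D_v f y) (x + s *: v) w h h0.
  by move=> t tI; apply: dDf; exact: hU.
by exists s, t; split => //; rewrite gE DE.
Qed.

Lemma continuous_dist_le g x (e : R) : {for x, continuous g} -> 0 < e ->
  exists2 d, 0 < d & forall y, `|x - y| < d -> `|g x - g y| <= e.
Proof.
move=> gC e0; move/cvgrPdist_le: gC => /(_ e e0) /nbhs_ballP[d /= d0 dB].
by exists d => // y xy; apply: dB; rewrite -ball_normE.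
Qed.

Lemma open_dist (U : set V) x : open U -> U x ->
  exists2 d, 0 < d & forall y, `|x - y| < d -> U y.
Proof.
move=> oU Ux; have /nbhs_ballP[d /= d0 dB] : nbhs x U by apply: open_nbhs_nbhs.
by exists d => // y xy; apply: dB; rewrite -ball_normE.
Qed.

Lemma distr_le_halves (a b c e : R) :
  `|a - c| <= e / 2 -> `|b - c| <= e / 2 -> `|a - b| <= e.
Proof.
move=> ac bc; rewrite (splitr e) -(subrKA c) (le_trans (ler_normD _ _)) //.
by rewrite lerD // distrC.
Qed.

(* Both mixed derivatives are limits of the same second difference quotient. *)
Lemma derive_sym (U : set V) f x v w : open U -> U x -> Ck_on 2 U f ->
  'D_w (fun y => 'D_v f y) x = 'D_v (fun y => 'D_w f y) x.
Proof.
move=> oU Ux fC.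
suff sub e : 0 < e ->
    `|'D_w (fun y => 'D_v f y) x - 'D_v (fun y => 'D_w f y) x| <= e.
  apply/eqP; rewrite -subr_eq0 -normr_le0; apply/ler_addgt0Pr => e e0.
  by rewrite add0r; exact: sub.
move=> e0.
have [_ Df] := fC.
have C1 : {for x, continuous (fun y => 'D_w (fun z => 'D_v f z) y)}.
  by have [_ DDf] := Df v; apply: DDf.
have C2 : {for x, continuous (fun y => 'D_v (fun z => 'D_w f z) y)}.
  by have [_ DDf] := Df w; apply: DDf.
have e20 : 0 < e / 2 by rewrite divr_gt0.
have [d1 d10 B1] := continuous_dist_le C1 e20.
have [d2 d20 B2] := continuous_dist_le C2 e20.
have [d3 d30 B3] := open_dist oU Ux.
pose d := Num.min d1 (Num.min d2 d3).
have d0 : 0 < d by rewrite !lt_min d10 d20.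
have dB y : `|x - y| < d -> [/\ U y,
     `|'D_w (fun z => 'D_v f z) x - 'D_w (fun z => 'D_v f z) y| <= e / 2 &
     `|'D_v (fun z => 'D_w f z) x - 'D_v (fun z => 'D_w f z) y| <= e / 2].
  by rewrite !lt_min => /and3P[y1 y2 y3]; split; [exact: B3|exact: B1|exact: B2].
(* This makes [h * (|v| + |w| + 1)] equal to [d / 2], so that the whole parallelogram of sides
   [h *: v] and [h *: w] lies within distance less than [d] of [x]; the summand [1] keeps the
   divisor positive. *)
pose h := d / 2 / (`|v| + `|w| + 1).
have vw0 : 0 < `|v| + `|w| + 1 by rewrite ltr_wpDl // addr_ge0.
have h0 : 0 < h by rewrite !divr_gt0.
have hB s t : 0 <= s <= h -> 0 <= t <= h -> `|x - (x + s *: v + t *: w)| < d.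
  move=> /andP[s0 sh] /andP[t0 th]; rewrite -addrA opprD addNKr normrN.
  apply: le_lt_trans (ler_normD _ _) _; rewrite !normrZ !ger0_norm //.
  apply: (@le_lt_trans _ _ (h * (`|v| + `|w| + 1))).
    rewrite !mulrDr mulr1; apply: ler_wpDr; first exact: ltW.
    by apply: lerD; rewrite ler_wpM2r.
  by rewrite /h divfK ?gt_eqF // ltr_pdivrMr // ltr_pMr // ltr1n.
have [|s [t [sI tI E1]]] := @second_difference U f x v w h h0 fC.
  by move=> s t sI tI; by case: (dB _ (hB _ _ sI tI)).
have [|t' [s' [tI' sI' E2]]] := @second_difference U f x w v h h0 fC.
  by move=> s' t' sI' tI'; rewrite addrAC; case: (dB _ (hB _ _ tI' sI')).
have [_ D1 _] := dB _ (hB _ _ sI tI).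
have [_ _ D2] := dB _ (hB _ _ sI' tI').
rewrite (addrAC x (s' *: v)) in D2.
(* The second difference is symmetric in [v] and [w]; dividing by [h] twice equates the mixed
   derivatives at the two intermediate points. *)
have E : 'D_w (fun y => 'D_v f y) (x + s *: v + t *: w) =
         'D_v (fun y => 'D_w f y) (x + t' *: w + s' *: v).
  apply: (mulIf (lt0r_neq0 h0)); apply: (mulIf (lt0r_neq0 h0)).
  have Ex : x + h *: w + h *: v = x + h *: v + h *: w by rewrite addrAC.
  have aux (F a b g : R) : F - a - (b - g) = F - b - (a - g).
    by rewrite !opprB addrACA [RHS]addrACA [- a + _]addrC.
  by rewrite -[LHS]E1 -[RHS]E2 Ex; exact: aux.
rewrite -E in D2.
exact: distr_le_halves D1 D2.
Qed.

End Schwarz.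

(** * Calculus of multilinear functions with variable arguments *)

Section DeriveSum.
Context {R : realType} {V : normedModType R}.

Lemma derive_sum_fun (W : normedModType R) (I : Type) (s : seq I)
    (f : I -> V -> W) x v : (forall i, differentiable (f i) x) ->
  'D_v (fun y => \sum_(i <- s) f i y) x = \sum_(i <- s) 'D_v (f i) x.
Proof.
move=> df.
suff : differentiable (fun y => \sum_(i <- s) f i y) x /\
  'D_v (fun y => \sum_(i <- s) f i y) x = \sum_(i <- s) 'D_v (f i) x by case.
elim: s => [|i s [dfs Dfs]].
  under eq_fun do rewrite big_nil; rewrite big_nil derive_cst.
  by split => //; exact: differentiable_cst.
under eq_fun do rewrite big_cons; rewrite big_cons; split.
  exact: differentiableD.
by rewrite -Dfs deriveD //; exact: diff_derivable.
Qed.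

Lemma derive_coord N (f : V -> 'rV[R]_N) x v j : differentiable f x ->
  'D_v (fun y => f y 0 j) x = 'D_v f x 0 j.
Proof. by move=> df; rewrite derive_mx ?mxE //; exact: diff_derivable. Qed.

Lemma deriveMfun (f g : V -> R) x v :
  differentiable f x -> differentiable g x ->
  'D_v (fun y => f y * g y) x = f x * 'D_v g x + 'D_v f x * g x.
Proof.
move=> df dg; rewrite deriveM; [|exact: diff_derivable..].
by rewrite [in RHS](mulrC ('D_v f x)).
Qed.

Lemma deriveMcl (c : R) (f : V -> R) x v : differentiable f x ->
  'D_v (fun y => c * f y) x = c * 'D_v f x.
Proof. by move=> df; rewrite (deriveZ c) //; exact: diff_derivable. Qed.

End DeriveSum.

Section MultilinearCalculus.
Context {R : realType} {V : normedModType R} {q N k : nat}.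
Variables (U : set V) (U' : set 'rV[R]_q).
Variables (phi : V -> 'rV[R]_q) (B : 'rV[R]_q -> ('I_k -> 'rV[R]_N) -> R).
Variable (u : 'I_k -> V -> 'rV[R]_N).
Hypotheses (oU : open U) (oU' : open U').
Hypotheses (phiC : smooth_on U phi) (phiU : forall x, U x -> U' (phi x)).
Hypotheses (BM : forall p, U' p -> multilinear (B p)).
Hypotheses (BC : forall w, smooth_on U' (B^~ w)).
Hypotheses (uC : forall b, smooth_on U (u b)).

(* Only the arguments in [s] vary; induction on [s] frees them one at a time. *)
Let mix (s : seq 'I_k) (w : 'I_k -> 'rV[R]_N) z b :=
  if b \in s then u b z else w b.

Let mix_cons s w m z : m \notin s ->
  mix (m :: s) w z = dfwith (mix s w z) m (u m z).
Proof.
move=> ms; apply/funext => b; rewrite /mix dfwithE in_cons.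
by have [->|] := eqVneq b m.
Qed.

Let mix_dfwith s w m e z : m \notin s ->
  mix s (dfwith w m e) z = dfwith (mix s w z) m e.
Proof.
move=> ms; apply/funext => b; rewrite /mix !dfwithE.
by have [->|] := eqVneq b m; first by rewrite (negPf ms).
Qed.

Let mix_expand s w m z : m \notin s -> U z ->
  B (phi z) (mix (m :: s) w z) = \sum_(j < N) u m z 0 j *
    B (phi z) (mix s (dfwith w m (delta_mx 0 j)) z).
Proof.
move=> ms Uz; rewrite mix_cons // {1}(row_sum_delta (u m z)).
rewrite multilinear_sum; last exact/BM/phiU.
by apply: eq_bigr => j _; rewrite mix_dfwith.
Qed.

Let mix_smooth s w : uniq s -> smooth_on U (fun z => B (phi z) (mix s w z)).
Proof.
elim: s w => [|m s IHs] w; first by move=> _; exact: smooth_on_comp (BC w).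
move=> /= /andP[ms us].
apply: (@smooth_on_eq _ _ _ _ _ _ oU (fun z Uz => esym (mix_expand w ms Uz))).
apply: smooth_on_sum => // j; apply: smooth_onM => //; last exact: IHs.
exact: smooth_on_coord (uC m).
Qed.

Let mix_derive s w x v : uniq s -> U x ->
  'D_v (fun z => B (phi z) (mix s w z)) x =
  'D_('D_v phi x) (B^~ (mix s w x)) (phi x) +
  \sum_(b <- s) B (phi x) (dfwith (mix s w x) b ('D_v (u b) x)).
Proof.
move=> + Ux; have dphi := smooth_on_differentiable phiC Ux.
have dB w' : differentiable (B^~ w') (phi x).
  by apply: smooth_on_differentiable (BC w') _; exact: phiU.
have BMx := BM (phiU Ux).
elim: s w => [|m s IHs] w.
  by move=> _; rewrite big_nil addr0 (@derive_comp _ _ _ _ phi (B^~ w)).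
move=> /= /andP[ms us].
have du := smooth_on_differentiable (uC m) Ux.
have duj j : differentiable (fun z => u m z 0 j) x.
  exact: smooth_on_differentiable (smooth_on_coord j oU (uC m)) Ux.
have dF w' := smooth_on_differentiable (mix_smooth w' us) Ux.
rewrite (open_derive_eq _ oU Ux (fun z Uz => mix_expand w ms Uz)).
rewrite derive_sum_fun; last first.
  by move=> j; apply: differentiableM; [exact: duj|exact: dF].
pose w0 := mix s w x; pose e j : 'rV[R]_N := delta_mx 0 j.
have E j : 'D_v (fun z => u m z 0 j *
      B (phi z) (mix s (dfwith w m (e j)) z)) x =
    u m x 0 j * 'D_('D_v phi x) (B^~ (dfwith w0 m (e j))) (phi x) +
    u m x 0 j * (\sum_(b <- s)
      B (phi x) (dfwith (dfwith w0 m (e j)) b ('D_v (u b) x))) +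
    'D_v (u m) x 0 j * B (phi x) (dfwith w0 m (e j)).
  rewrite deriveMfun; [|exact: duj|exact: dF].
  by rewrite derive_coord // IHs // mix_dfwith // mulrDr.
rewrite (eq_bigr _ (fun j _ => E j)).
(* The three sums come from the variation of [phi], of the argument [m] and of the arguments in [s];
   each is reassembled from its expansion in the basis [e] by multilinearity. *)
rewrite !big_split /= mix_cons // big_cons dfwith_dfwith addrAC -addrA.
congr (_ + _); [|congr (_ + _)].
- rewrite [in RHS](row_sum_delta (u m x)).
  rewrite (@open_derive_eq _ _ _ U' _ (fun p =>
    \sum_j u m x 0 j * B p (dfwith w0 m (e j)))) //; last 2 first.
  + exact: phiU.
  + by move=> p /BM Bp; rewrite multilinear_sum.
  rewrite derive_sum_fun; last by move=> j; apply: differentiableZ; exact: dB.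
  by apply: eq_bigr => j _; rewrite deriveMcl.
- by rewrite [in RHS](row_sum_delta ('D_v (u m) x)) multilinear_sum.
under eq_bigr do rewrite mulr_sumr.
rewrite exchange_big /= big_seq [RHS]big_seq; apply: eq_bigr => b bs.
have mb : m != b by apply: contraNneq ms => ->.
rewrite dfwithC // [in RHS](row_sum_delta (u m x)) multilinear_sum //.
by apply: eq_bigr => j _; rewrite dfwithC.
Qed.

Lemma smooth_on_multilinear : smooth_on U (fun z => B (phi z) (u ^~ z)).
Proof.
(* With [s] the list of all indices, every default argument [0] is overwritten. *)
have := mix_smooth (fun=> 0) (enum_uniq 'I_k).
by apply: smooth_on_eq => // z _; congr B; apply/funext => b; rewrite /mix mem_enum.
Qed.

Lemma derive_multilinear x v : U x ->
  'D_v (fun z => B (phi z) (u ^~ z)) x =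
  'D_('D_v phi x) (B^~ (u ^~ x)) (phi x) +
  \sum_b B (phi x) (dfwith (u ^~ x) b ('D_v (u b) x)).
Proof.
move=> Ux; have := mix_derive (fun=> 0) v (enum_uniq 'I_k) Ux.
have mixE z : mix (enum 'I_k) (fun=> 0) z = u ^~ z.
  by apply/funext => b; rewrite /mix mem_enum.
by under eq_fun do rewrite mixE; rewrite mixE big_enum.
Qed.

End MultilinearCalculus.

(** * The exterior derivative in coordinates, and its invariance under pullback *)

Section LocalExtd.
Context {R : realType}.

(** The formula of [extd] for a function on coordinate space, in one fixed chart, so that different
    charts can be compared. *)
Definition loc_extd N k (B : 'rV[R]_N -> ('I_k -> 'rV[R]_N) -> R)
    (y : 'rV[R]_N) (v : 'I_k.+1 -> 'rV[R]_N) : R :=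
  \sum_(a < k.+1) (-1) ^+ a * 'D_(v a) (fun z => B z (v \o lift a)) y.

Lemma loc_extd_eq N k (U : set 'rV[R]_N)
    (B B' : 'rV[R]_N -> ('I_k -> 'rV[R]_N) -> R) y :
  open U -> U y -> (forall z v, U z -> B z v = B' z v) ->
  loc_extd B y = loc_extd B' y.
Proof.
move=> oU Uy BB'; apply/funext => v; apply: eq_bigr => a _; congr (_ * _).
by apply: open_derive_eq oU Uy _ => z Uz; exact: BB'.
Qed.

Section Chart.
Context {N k : nat}.
Variables (U : set 'rV[R]_N) (B : 'rV[R]_N -> ('I_k -> 'rV[R]_N) -> R).
Hypotheses (oU : open U) (BA : forall p, U p -> alt_multilinear (B p)).
Hypotheses (BC : forall w, smooth_on U (B^~ w)).

Lemma loc_extd_smooth v : smooth_on U (fun y => loc_extd B y v).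
Proof.
apply: smooth_on_sum => // a; apply: smooth_onM => //.
  exact: smooth_on_cst.
exact: smooth_on_derive.
Qed.

Lemma loc_extd_alt y : U y -> alt_multilinear (loc_extd B y).
Proof.
move=> Uy; have dB w : differentiable (B^~ w) y.
  exact: smooth_on_differentiable (BC w) Uy.
split=> [v a c w w'|v a b ab vab].
  rewrite /loc_extd mulr_sumr -big_split; apply: eq_bigr => a' _ /=.
  rewrite mulrCA -mulrDr; congr (_ * _).
  (* For [a' = a] the slot is the direction of differentiation; otherwise it is an argument of [B],
     whose linearity is used under the derivative. *)
  have [<-|aa'] := eqVneq a a'.
    by rewrite !dfwith_lift_eq !dfwithE eqxx derive_linear.
  have [b ->] : exists b, a = lift a' b.
    by case: (unliftP a' a) aa' => [b ->|->]; [exists b|rewrite eqxx].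
  rewrite !dfwith_lift !dfwithE (negPf (neq_lift _ _)).
  rewrite (@open_derive_eq _ _ _ U _ (fun z =>
    c * B z (dfwith (v \o lift a') b w) + B z (dfwith (v \o lift a') b w'))) //.
    rewrite deriveD ?deriveMcl //; apply: diff_derivable => //.
    by apply: differentiableZ.
  by move=> z /BA[BM _]; rewrite BM.
(* Every term other than those of [a] and [b] still has a repeated argument under the derivative,
   hence vanishes. *)
rewrite /loc_extd (bigD1 a) //= (bigD1 b) 1?eq_sym //= big1 ?addr0; last first.
  move=> c /andP[ca cb].
  have [a' ea] : exists a', a = lift c a'.
    by case: (unliftP c a) ca => [a' ->|->]; [exists a'|rewrite eqxx].
  have [b' eb] : exists b', b = lift c b'.
    by case: (unliftP c b) cb => [b' ->|->]; [exists b'|rewrite eqxx].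
  rewrite (@open_derive_eq _ _ _ U _ (cst 0)) ?derive_cst ?mulr0 //.
  move=> z /BA[_ BA0]; apply: (BA0 _ a' b'); last by rewrite /= -ea -eb.
  by apply: contraNneq ab => e; rewrite ea eb e.
(* Since [v a = v b], the two remaining derivatives have the same direction and combine into that of
   a function vanishing on [U] by [alt_lift]. *)
rewrite -vab -!deriveMcl // -deriveD;
  [|by apply: diff_derivable; apply: differentiableZ..].
rewrite (@open_derive_eq _ _ _ U _ (cst 0)) ?derive_cst //.
by move=> z /BA Bz; apply: (alt_lift Bz).
Qed.

End Chart.

(** The Leibniz rule produces the expected terms together with second derivatives of [phi]; the
    latter are symmetric and cancel in the alternating sum. *)
Lemma loc_extd_pullback N N' k (U : set 'rV[R]_N) (U' : set 'rV[R]_N')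
    (phi : 'rV[R]_N -> 'rV[R]_N') (B : 'rV[R]_N' -> ('I_k -> 'rV[R]_N') -> R) :
  open U -> open U' -> smooth_on U phi -> (forall x, U x -> U' (phi x)) ->
  (forall p, U' p -> alt_multilinear (B p)) ->
  (forall w, smooth_on U' (B^~ w)) ->
  forall x v, U x ->
  loc_extd (fun z v => B (phi z) (fun b => 'D_(v b) phi z)) x v =
  loc_extd B (phi x) (fun b => 'D_(v b) phi x).
Proof.
move=> oU oU' phiC phiU BA BC x v Ux.
pose S a b := 'D_(v a) (fun z => 'D_(v b) phi z) x.
have dphi w y : U y -> differentiable (fun z => 'D_w phi z) y.
  by move=> Uy; apply: smooth_on_differentiable Uy; exact: smooth_on_derive.
(* Symmetry of second derivatives is available for real-valued functions, hence the passage to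
   components. *)
have SE a b j :
    S a b 0 j = 'D_(v a) (fun z => 'D_(v b) (fun z => phi z 0 j) z) x.
  apply: etrans (esym (derive_coord (v a) j (dphi (v b) x Ux))) _.
  apply: open_derive_eq oU Ux _ => y Uy; apply/esym/derive_coord.
  exact: smooth_on_differentiable Uy.
have Ssym a b : S a b = S b a.
  apply/rowP => j; apply: etrans (SE a b j) _; apply: etrans _ (esym (SE b a j)).
  exact: (derive_sym _ _ oU Ux (smooth_on_coord j oU phiC 2%N)).
have E a : 'D_(v a) (fun z => B (phi z) (fun b => 'D_((v \o lift a) b) phi z)) x
  = 'D_('D_(v a) phi x) (B^~ ((fun b => 'D_(v b) phi x) \o lift a)) (phi x) +
    \sum_b B (phi x) (dfwith ((fun b => 'D_(v b) phi x) \o lift a) b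
                        (S a (lift a b))).
  rewrite (derive_multilinear oU oU' phiC phiU _ BC) //.
    by move=> p /BA[].
  by move=> b; exact: smooth_on_derive.
pose T a := 'D_('D_(v a) phi x)
  (B^~ ((fun b => 'D_(v b) phi x) \o lift a)) (phi x).
transitivity (\sum_(a < k.+1) ((-1) ^+ a * T a + (-1) ^+ a *
    \sum_b B (phi x) (dfwith ((fun b => 'D_(v b) phi x) \o lift a) b
                        (S a (lift a b))))).
  by apply: eq_bigr => a _; rewrite -mulrDr; congr (_ * _); exact: E.
rewrite big_split /= [X in _ + X]alt_lift_sym_sum ?addr0 //.
exact/BA/phiU.
Qed.

End LocalExtd.

(** * The exterior derivative in arbitrary charts *)

(* A manifold, without the Hausdorff and second countability axioms. *)
Record smooth_atlas (R : realType) (N : nat) (X : atlas R N) : Prop := {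
  atlas_coordK : forall (i : chart X) (x : X),
    dom i x -> param i (coord i x) = x;
  atlas_dom_chart_at : forall x : X, dom (chart_at x) x;
  atlas_dom_open : forall i : chart X, mopen (dom i);
  atlas_coord_smooth : forall i j : chart X,
    smooth_on (coord i @` (dom i `&` dom j)) (coord j \o param i) }.

Arguments atlas_dom_open {R N X} XS i i' : rename.
Arguments atlas_coord_smooth {R N X} XS i j : rename.

Lemma manifold_smooth_atlas (R : realType) (n : nat) (M : manifold R n) :
  smooth_atlas M.
Proof. by case: (manifoldP M). Qed.

Section AtlasForms.
Context {R : realType} {N : nat} {X : atlas R N}.
Hypothesis XS : smooth_atlas X.
Implicit Types (i c : chart X) (x : X) (y w : 'rV[R]_N).

Lemma open_coord_dom i : open (coord i @` dom i).
Proof. by have := atlas_dom_open XS i i; rewrite setIid. Qed.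
Arguments open_coord_dom i : clear implicits.

Lemma dom_param i y : (coord i @` dom i) y -> dom i (param i y).
Proof. by move=> [x ix <-]; rewrite (atlas_coordK XS). Qed.

Lemma paramK i y : (coord i @` dom i) y -> coord i (param i y) = y.
Proof. by move=> [x ix <-]; rewrite (atlas_coordK XS). Qed.

(** [dparam i y] differentiates the transition from [i] to the chart selected at [param i y]; this
    places [y] in the domain where that transition is smooth. *)
Lemma overlap_chart_at i y : (coord i @` dom i) y ->
  (coord i @` (dom i `&` dom (chart_at (param i y)))) y.
Proof.
move=> iy; exists (param i y); last exact: paramK.
by split; [exact: dom_param|exact: atlas_dom_chart_at].
Qed.

Lemma differentiable_transition i c y :
  (coord i @` (dom i `&` dom c)) y -> differentiable (coord c \o param i) y.
Proof. exact/smooth_on_differentiable/atlas_coord_smooth. Qed.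

Lemma dparam_linear i y a w w' : (coord i @` dom i) y ->
  dparam i y (a *: w + w') = a *: dparam i y w + dparam i y w'.
Proof.
by move=> /overlap_chart_at /differentiable_transition; exact: derive_linear.
Qed.

Lemma dparam0 i y : dparam i y 0 = 0.
Proof. exact: derive0. Qed.

Lemma dparam_chart_at x w :
  dparam (chart_at x) (coord (chart_at x) x) w = w.
Proof.
have xx := atlas_dom_chart_at XS x; rewrite /dparam (atlas_coordK XS) //.
rewrite -[RHS](derive_id (coord (chart_at x) x) w).
apply: (open_derive_eq _ (open_coord_dom (chart_at x))) => [|y /paramK //].
by exists x => //; exact: atlas_dom_chart_at.
Qed.

(** Chain rule for the passage from [i] through [c] to the selected chart [d], in which tangent
    vectors are represented. *)
Lemma dparam_transition i c y w : (coord i @` (dom i `&` dom c)) y ->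
  dparam c (coord c (param i y)) ('D_w (coord c \o param i) y) = dparam i y w.
Proof.
move=> icy; have [x [ix cx] xy] := icy.
have px : param i y = x by rewrite -xy (atlas_coordK XS).
pose phi := coord c \o param i; pose d := chart_at (param i y).
have phiy : phi y = coord c x by rewrite /phi /= px.
have pc : param c (phi y) = param i y by rewrite phiy px (atlas_coordK XS).
have dphi : differentiable phi y by exact: differentiable_transition.
have dd : differentiable (coord d \o param c) (phi y).
  apply: differentiable_transition; exists x => //; split => //.
  by rewrite /d px; exact: atlas_dom_chart_at.
rewrite {1}/dparam -[coord c (param i y)]/(phi y) pc.
apply: etrans (esym (derive_comp w dphi dd)) _.
apply: open_derive_eq (atlas_dom_open XS c i) icy _ => z [x' [ix' cx'] <-].
by rewrite /phi /= (atlas_coordK XS ix') (atlas_coordK XS cx').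
Qed.

Context {k : nat}.
Implicit Types (om : pform X k) (v : 'I_k -> 'rV[R]_N).

Lemma local_rep_transition om i c y v : (coord i @` (dom i `&` dom c)) y ->
  local_rep om c ((coord c \o param i) y)
    (fun b => 'D_(v b) (coord c \o param i) y) = local_rep om i y v.
Proof.
move=> icy; rewrite /local_rep /=.
have [x [ix cx] xy] := icy.
have -> : param c (coord c (param i y)) = param i y.
  by rewrite -xy (atlas_coordK XS) // (atlas_coordK XS).
by congr (om _ _); apply/funext => b; exact: dparam_transition.
Qed.

Lemma local_rep_alt om i y : is_form om -> (coord i @` dom i) y ->
  alt_multilinear (local_rep om i y).
Proof.
move=> [omA _] iy; have [omM om0] := omA (param i y).
split=> [v a c w w'|v a b ab vab].
  have E u : (fun b => dparam i y (dfwith v a u b)) =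
      dfwith (fun b => dparam i y (v b)) a (dparam i y u) by exact: comp_dfwith.
  pose g u := om (param i y) (dfwith (fun b => dparam i y (v b)) a u).
  have Eg u : local_rep om i y (dfwith v a u) = g (dparam i y u).
    exact: (congr1 (om (param i y)) (E u)).
  apply: etrans (Eg _) _; apply: etrans (congr1 g (dparam_linear c w w' iy)) _.
  apply: etrans (omM _ _ _ _ _) _.
  exact: (congr2 (fun s t => c * s + t) (esym (Eg w)) (esym (Eg w'))).
exact: (om0 _ a b ab (congr1 (dparam i y) vab)).
Qed.

(** At [y] the left side is [loc_extd] in the selected chart [c], evaluated on vectors pushed
    forward by the transition map [phi]. Invariance under pullback by [phi] turns it into the
    formula in the chart [i]. *)
Lemma local_rep_extd om i y (v : 'I_k.+1 -> 'rV[R]_N) : is_form om ->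
  (coord i @` dom i) y ->
  local_rep (extd om) i y v = loc_extd (local_rep om i) y v.
Proof.
move=> omF iy; have ic := overlap_chart_at iy.
set c := chart_at (param i y) in ic.
pose phi := coord c \o param i.
have phiU z : (coord i @` (dom i `&` dom c)) z -> (coord c @` dom c) (phi z).
  move=> [x [ix cx] <-]; exists x => //.
  by rewrite /phi /= (atlas_coordK XS).
have E := @loc_extd_pullback R N N k _ _ phi (local_rep om c)
  (atlas_dom_open XS c i) (open_coord_dom c) (atlas_coord_smooth XS i c) phiU.
have {E} E := E (fun p => local_rep_alt omF) (omF.2 c) y v ic.
apply: etrans (esym E) _.
have L := @loc_extd_eq R N k _ (fun z v => local_rep om c (phi z)
  (fun b => 'D_(v b) phi z)) (local_rep om i) y (atlas_dom_open XS c i) ic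
  (fun z v => @local_rep_transition om i c z v).
exact: (congr1 (fun f => f v) L).
Qed.

Lemma is_form_extd om : is_form om -> is_form (extd om).
Proof.
move=> omF; split=> [x|i v].
  apply: (loc_extd_alt (open_coord_dom (chart_at x))).
  - by move=> p; exact: local_rep_alt.
  - exact: omF.2.
  - by exists x => //; exact: atlas_dom_chart_at.
apply: (smooth_on_eq (open_coord_dom i)).
  by move=> y iy; apply/esym/(local_rep_extd _ omF iy).
by apply: loc_extd_smooth; [exact: open_coord_dom|exact: omF.2].
Qed.

End AtlasForms.
Arguments open_coord_dom {R N X} XS i.

(** * The total space of a vector bundle *)

Section RowBlocks.
Context {R : realType} {n r : nat}.

Lemma smooth_on_row_mx (V : normedModType R) (U : set V)
    (f : V -> 'rV[R]_n) (g : V -> 'rV[R]_r) : open U ->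
  smooth_on U f -> smooth_on U g -> smooth_on U (fun x => row_mx (f x) (g x)).
Proof.
move=> oU fC gC; apply: smooth_on_row => // j; case: (split_ordP j) => k ->.
  by under eq_fun do rewrite row_mxEl; exact: smooth_on_coord.
by under eq_fun do rewrite row_mxEr; exact: smooth_on_coord.
Qed.

Lemma smooth_on_comp_row (V : normedModType R) (U : set V) (U' : set 'rV[R]_n)
    (f : V -> 'rV[R]_n) (g : 'rV[R]_n -> 'rV[R]_r) : open U -> open U' ->
  (forall x, U x -> U' (f x)) ->
  smooth_on U f -> smooth_on U' g -> smooth_on U (g \o f).
Proof.
move=> oU oU' fU fC gC; apply: smooth_on_row => // j.
exact: smooth_on_comp fU fC (smooth_on_coord j oU' gC).
Qed.

Lemma open_lsubmx (U : set 'rV[R]_n) :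
  open U -> open (lsubmx @^-1` U : set 'rV[R]_(n + r)).
Proof. by move=> oU; apply: open_comp => // x _; exact: continuous_lsubmx. Qed.

Lemma smooth_on_lsubmx (U : set 'rV[R]_(n + r)) : open U ->
  smooth_on U (lsubmx : 'rV[R]_(n + r) -> 'rV[R]_n).
Proof.
move=> oU; have := @smooth_on_id R 'rV[R]_(n + r) U.
exact: (@smooth_on_linear _ _ _ _ _ _ (@lsubmx R 1 n r)).
Qed.

Lemma smooth_on_rsubmx (U : set 'rV[R]_(n + r)) : open U ->
  smooth_on U (rsubmx : 'rV[R]_(n + r) -> 'rV[R]_r).
Proof.
move=> oU; have := @smooth_on_id R 'rV[R]_(n + r) U.
exact: (@smooth_on_linear _ _ _ _ _ _ (@rsubmx R 1 n r)).
Qed.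

Section FibreLinear.
Variables (U : set 'rV[R]_n) (h : 'rV[R]_n -> 'rV[R]_r -> R).
Hypotheses (oU : open U).
Hypotheses (hL : forall x c e e', U x -> h x (c *: e + e') = c * h x e + h x e').
Hypotheses (hC : forall e, smooth_on U (h^~ e)).

(** A function linear in the fibre variable is seen as a multilinear function of one argument, so
    that the preceding calculus applies with the base point as parameter. *)
Let B x (e : 'I_1 -> 'rV[R]_r) := h x (e ord0).

Let BM x : U x -> multilinear (B x).
Proof.
by move=> Ux v a c w w'; rewrite /B !dfwithE (ord1 a) eqxx hL.
Qed.

Lemma smooth_on_fibre_linear :
  smooth_on (lsubmx @^-1` U) (fun z => h (lsubmx z) (rsubmx z)).
Proof.
have oU' := open_lsubmx oU.
apply: (@smooth_on_multilinear _ _ _ _ _ _ U lsubmx B (fun _ => rsubmx)) => //.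
- exact: smooth_on_lsubmx.
- by move=> e; exact: hC.
- by move=> b; exact: smooth_on_rsubmx.
Qed.

Lemma derive_fibre_linear z w : U (lsubmx z) ->
  'D_w (fun z => h (lsubmx z) (rsubmx z)) z =
  'D_(lsubmx w) (h^~ (rsubmx z)) (lsubmx z) + h (lsubmx z) (rsubmx w).
Proof.
move=> Uz; have oU' := open_lsubmx oU.
have := @derive_multilinear _ _ _ _ _ _ U lsubmx B (fun _ => rsubmx)
  oU' oU (smooth_on_lsubmx oU') (fun _ => id) BM (fun e => hC (e ord0))
  (fun _ => smooth_on_rsubmx oU') z w Uz.
rewrite big_ord1 => E; apply: etrans E _.
rewrite [X in 'D_X _ _](derive_linear_row (@lsubmx R 1 n r)).
congr (_ + _); rewrite /B dfwithE eqxx; congr h.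
exact: (derive_linear_row (@rsubmx R 1 n r)).
Qed.

End FibreLinear.

End RowBlocks.

Section TotalSpace.
Context {R : realType} {n r : nat} {M : manifold R n} (A : vbundle M r).
Implicit Types (i : chart M) (j : tidx A) (m : M).
Notation E := (total_space A).

Let MS := manifold_smooth_atlas M.

Lemma triv_inv_linear j m c e e' : tdom j m ->
  triv_inv j m (c *: e + e') = c *: triv_inv j m e + triv_inv j m e'.
Proof.
move=> jm; apply: (can_inj (trivK jm)).
by rewrite linearP !(triv_invK jm).
Qed.

(** Fibre coordinates are unrestricted over a trivializing domain, so the images of such sets are
    cylinders over images in the base. *)
Lemma image_coord_total i j (O : set M) :
  coord ((i, j) : chart E) @` (dom ((i, j) : chart E) `&` [set u : E | O (tag u)])
  = lsubmx @^-1` (coord i @` (dom i `&` (tdom j `&` O))).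
Proof.
apply/seteqP; split=> [_ [[m e] /= [[im jm] Om] <-]|y [m [im [jm Om]] my]] /=.
  by exists m => //; rewrite row_mxKl.
exists (in_total (triv_inv j m (rsubmx y))) => //=.
by rewrite my (triv_invK jm) hsubmxK.
Qed.

(** Injectivity of [coord i] on [dom i] makes the image commute with the intersection. *)
Lemma mopenI i (O O' : set M) :
  open (coord i @` (dom i `&` O)) -> open (coord i @` (dom i `&` O')) ->
  open (coord i @` (dom i `&` (O `&` O'))).
Proof.
move=> oO oO'.
rewrite (_ : _ @` _ = coord i @` (dom i `&` O) `&` coord i @` (dom i `&` O')).
  exact: openI.
apply/seteqP; split=> [y [m [im [Om Om']] my]|y [[m [im Om] my] [m' [im' Om'] my']]].
  by split; exists m.
exists m => //; split => //; split => //.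
by rewrite -(atlas_coordK MS im) my -my' (atlas_coordK MS im').
Qed.

Lemma open_tdom i j : open (coord i @` (dom i `&` tdom j)).
Proof. exact: tdom_open. Qed.

Lemma open_overlap i i' j j' :
  open (coord i @` (dom i `&` (tdom j `&` (dom i' `&` tdom j')))).
Proof.
by do 2 (apply: mopenI; first exact: open_tdom || exact: (atlas_dom_open MS i' i));
  exact: open_tdom.
Qed.
Arguments open_overlap i i' j j' : clear implicits.

(** A change of charts acts on base coordinates as in [M], and on fibre coordinates linearly with
    coefficients smooth in the base point. *)
Lemma total_smooth_atlas : smooth_atlas E.
Proof.
split.
- move=> [i j] [m e] /= [im jm]; rewrite row_mxKl row_mxKr (atlas_coordK MS im).
  by rewrite (trivK jm).
- by move=> [m e] /=; split; [exact: atlas_dom_chart_at|exact: tdom_triv_at].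
- move=> [i' j'] [i j]; rewrite (image_coord_total i j (dom i' `&` tdom j')).
  exact/open_lsubmx/open_overlap.
move=> [i j] [i' j']; rewrite (image_coord_total i j (dom i' `&` tdom j')).
have oU := open_overlap i i' j j'.
set U := coord i @` _ in oU *.
have oU' := @open_lsubmx _ _ r _ oU.
apply: smooth_on_row_mx => //.
  apply: (@smooth_on_comp_row _ n n _ _ U lsubmx (coord i' \o param i)) => //.
    exact: smooth_on_lsubmx.
  apply: smooth_on_subset (atlas_coord_smooth MS i i') => _ [m [im [_ [im' _]] <-]].
  by exists m.
apply: smooth_on_row => // k.
pose h x e := triv j' (param i x) (triv_inv j (param i x) e) 0 k.
apply: (@smooth_on_fibre_linear _ _ _ U h) => //.
  move=> x c e e' [m [im [jm _]] <-]; rewrite /h (atlas_coordK MS im).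
  by rewrite (triv_inv_linear _ _ _ jm) linearP !mxE.
move=> e; apply: smooth_on_coord => //.
apply: smooth_on_subset (triv_smooth j j' i e) => _ [m [im [jm [_ jm']]] <-].
by exists m.
Qed.

End TotalSpace.

(** * Base and vertical components of vectors tangent to the total space *)

Section TangentTotal.
Context {R : realType} {n r : nat} {M : manifold R n} (A : vbundle M r).
Implicit Types (i : chart M) (j : tidx A) (m : M).
Notation E := (total_space A).

Let MS := manifold_smooth_atlas M.
Let ES := total_smooth_atlas A.

Lemma total_coord_dom i j : coord ((i, j) : chart E) @` dom ((i, j) : chart E)
  = lsubmx @^-1` (coord i @` (dom i `&` tdom j)).
Proof.
have := image_coord_total i j setT; rewrite !setIT => <-.
by congr (_ @` _); apply/seteqP; split=> u // [].
Qed.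

Lemma tmap_proj (u : E) (U : 'rV[R]_(n + r)) : tmap (@proj R n r M A) u U = lsubmx U.
Proof.
case: u => m e; rewrite /tmap /=.
rewrite -[RHS](derive_linear_row (@lsubmx R 1 n r)
  (row_mx (coord (chart_at m) m) (triv (triv_at A m) m e))).
apply: (open_derive_eq _ (open_lsubmx (open_coord_dom MS (chart_at m)))).
  by exists m; rewrite ?row_mxKl //; exact: atlas_dom_chart_at.
by move=> y /= /(paramK MS).
Qed.

(** The base part of a change of bundle charts depends only on the base coordinates; both sides
    differentiate this identity [FE]. *)
Lemma lsubmx_dparam i j y (w : 'rV[R]_(n + r)) :
  (coord i @` (dom i `&` tdom j)) (lsubmx y) ->
  lsubmx (dparam ((i, j) : chart E) y w) = dparam i (lsubmx y) (lsubmx w).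
Proof.
move=> ijy; have Ey : (coord ((i, j) : chart E) @` dom ((i, j) : chart E)) y.
  by rewrite total_coord_dom.
have iy : (coord i @` dom i) (lsubmx y).
  by have [m [im _] <-] := ijy; exists m.
pose ij : chart E := (i, j).
have dE := differentiable_transition ES (overlap_chart_at ES Ey).
have dM := differentiable_transition MS (overlap_chart_at MS iy).
have DE := etrans (derive_comp w dE (differentiable_linear_row
  (@lsubmx R 1 n r) _)) (derive_linear_row (@lsubmx R 1 n r) _ _).
have DM := derive_comp w (differentiable_linear_row (@lsubmx R 1 n r) y) dM.
have FE : lsubmx \o (coord (chart_at (param ij y)) \o param ij) =
    (coord (chart_at (param i (lsubmx y))) \o param i) \o lsubmx.
  by apply/funext => z; exact: row_mxKl.
apply: etrans (esym DE) _; apply: etrans (congr1 (fun F => 'D_w F y) FE) _.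
apply: etrans DM _; congr ('D__ _ _).
exact: (derive_linear_row (@lsubmx R 1 n r)).
Qed.

(** Along the fibres a change of trivialization is linear, hence equal to its own derivative in
    vertical directions. *)
Lemma rsubmx_dparam_vertical i j y (e : 'rV[R]_r) :
  (coord i @` (dom i `&` tdom j)) (lsubmx y) ->
  rsubmx (dparam ((i, j) : chart E) y (row_mx 0 e)) =
  triv (triv_at A (param i (lsubmx y))) (param i (lsubmx y))
    (triv_inv j (param i (lsubmx y)) e).
Proof.
move=> ijy; have Ey : (coord ((i, j) : chart E) @` dom ((i, j) : chart E)) y.
  by rewrite total_coord_dom.
have dE := differentiable_transition ES (overlap_chart_at ES Ey).
set m := param i (lsubmx y); pose j' := triv_at A m; pose i' := chart_at m.
have im : (coord i @` (dom i `&` (tdom j `&` (dom i' `&` tdom j')))) (lsubmx y).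
  have [m' [im' jm'] mm'] := ijy.
  have mE : m = m' by rewrite /m -mm' (atlas_coordK MS im').
  exists m' => //; rewrite /i' /j' mE; do !split => //.
    exact: atlas_dom_chart_at.
  exact: tdom_triv_at.
apply/rowP => k; pose h x e := triv j' (param i x) (triv_inv j (param i x) e) 0 k.
pose f z := coord ((i', j') : chart E) (param ((i, j) : chart E) z).
have D1 : 'D_(row_mx 0 e) (rsubmx \o f) y = rsubmx ('D_(row_mx 0 e) f y).
  apply: etrans (derive_comp _ dE (differentiable_linear_row (@rsubmx R 1 n r) _)) _.
  exact: (derive_linear_row (@rsubmx R 1 n r)).
have D2 : 'D_(row_mx 0 e) (fun z => rsubmx (f z) 0 k) y =
    'D_(row_mx 0 e) (rsubmx \o f) y 0 k.
  apply: (derive_coord _ _ (differentiable_comp dE _)).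
  exact: (differentiable_linear_row (@rsubmx R 1 n r)).
apply: etrans (esym (etrans D2 (congr1 (fun u : 'rV[R]_r => u 0 k) D1))) _.
have fh z : rsubmx (f z) 0 k = h (lsubmx z) (rsubmx z) by rewrite /f /= row_mxKr.
rewrite (funext fh).
rewrite (@derive_fibre_linear _ _ _ (coord i @` (dom i `&`
  (tdom j `&` (dom i' `&` tdom j')))) h _ _ _ y).
- by rewrite row_mxKl derive0 add0r row_mxKr.
- exact: open_overlap.
- move=> x c e1 e2 [m1 [im1 [jm1 _]] <-]; rewrite /h (atlas_coordK MS im1).
  by rewrite (triv_inv_linear _ _ _ jm1) linearP !mxE.
- move=> e1; apply: smooth_on_coord; first exact: open_overlap.
  apply: smooth_on_subset (triv_smooth j j' i e1) => _ [m1 [im1 [jm1 [_ jm1']]] <-].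
  by exists m1.
- exact: im.
Qed.

End TangentTotal.

(** * The forms [Lambda_mu] *)

Section PulledBackForms.
Context {R : realType} {n r : nat} {M : manifold R n} {A : vbundle M r}.
Implicit Types (i : chart M) (j : tidx A) (m : M).
Notation E := (total_space A).

Let MS := manifold_smooth_atlas M.
Let ES := total_smooth_atlas A.

Context {l : nat}.
Variable mu : fiber_map A l.
Hypothesis muV : vb_morphism mu.

Lemma LamE (u : E) (U : 'I_l -> 'rV[R]_(n + r)) :
  Lam mu u U = mu (tagged u) (fun a => lsubmx (U a)).
Proof.
rewrite /Lam; congr (mu _ _).
by apply/funext => a; exact: tmap_proj.
Qed.

Definition mu_rep i j (x : 'rV[R]_n) (e : 'rV[R]_r) (X : 'I_l -> 'rV[R]_n) : R :=
  mu (triv_inv j (param i x) e) (fun a => dparam i x (X a)).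

Lemma mu_rep_linear i j x c e e' X : (coord i @` (dom i `&` tdom j)) x ->
  mu_rep i j x (c *: e + e') X = c * mu_rep i j x e X + mu_rep i j x e' X.
Proof.
move=> [m [im jm] <-]; rewrite /mu_rep (atlas_coordK MS im).
by rewrite (triv_inv_linear _ _ _ jm); case: muV => _ + _; apply.
Qed.

Lemma mu_rep_smooth i j e X :
  smooth_on (coord i @` (dom i `&` tdom j)) (fun x => mu_rep i j x e X).
Proof. by case: muV => _ _; apply. Qed.

Lemma local_rep_Lam i j y (v : 'I_l -> 'rV[R]_(n + r)) :
  (coord i @` (dom i `&` tdom j)) (lsubmx y) ->
  local_rep (Lam mu) ((i, j) : chart E) y v =
  mu_rep i j (lsubmx y) (rsubmx y) (fun a => lsubmx (v a)).
Proof.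
move=> ijy; rewrite /local_rep LamE /=; congr (mu _ _).
by apply/funext => a; exact: lsubmx_dparam.
Qed.

Lemma is_form_Lam : is_form (Lam mu).
Proof.
split=> [u|[i j] v].
  have [muA _ _] := muV; have [muM mu0] := muA (tag u) (tagged u).
  split=> [v a c w w'|v a b ab vab].
    have Lu w0 : Lam mu u (dfwith v a w0) =
        mu (tagged u) (dfwith (fun b => lsubmx (v b)) a (lsubmx w0)).
      by rewrite LamE; congr (mu _ _); exact: comp_dfwith.
    rewrite !Lu -muM; congr (mu _ (dfwith _ _ _)); exact: linearP.
  by rewrite LamE; apply: (mu0 _ a b ab); rewrite vab.
rewrite total_coord_dom.
have oU := @open_tdom _ _ _ _ A i j.
have oU' := @open_lsubmx _ _ r _ oU.
apply: (smooth_on_eq oU' (fun y ijy => esym (local_rep_Lam v ijy))).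
apply: (@smooth_on_fibre_linear _ _ _ _ (fun x e =>
  mu_rep i j x e (fun a => lsubmx (v a)))) => //.
  by move=> x c e e' ijx; exact: mu_rep_linear.
by move=> e; exact: mu_rep_smooth.
Qed.

(** The derivative along the base with the fibre coordinates of [e] frozen. It depends on the
    selected chart and trivialization. *)
Definition mu_deriv m (e : A m) (w : 'rV[R]_n) (X : 'I_l -> 'rV[R]_n) : R :=
  'D_w (fun x => mu_rep (chart_at m) (triv_at A m) x (triv (triv_at A m) m e) X)
    (coord (chart_at m) m).

Let center_in m :
  (coord (chart_at m) @` (dom (chart_at m) `&` tdom (triv_at A m)))
    (coord (chart_at m) m).
Proof.
exists m => //; split; first exact: atlas_dom_chart_at.
exact: tdom_triv_at.
Qed.

(** In bundle coordinates [Lam mu] is linear in the fibre variable, so the derivative along [U a]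
    splits into a base derivative and a substitution of the fibre component of [U a]. *)
Lemma extd_Lam m (e : A m) (U : 'I_l.+1 -> 'rV[R]_(n + r)) :
  extd (Lam mu) (in_total e) U = \sum_(a < l.+1) (-1) ^+ a *
    (mu_deriv e (lsubmx (U a)) (fun b => lsubmx (U (lift a b))) +
     mu (triv_inv (triv_at A m) m (rsubmx (U a)))
       (fun b => lsubmx (U (lift a b)))).
Proof.
apply: eq_bigr => a _; congr (_ * _).
pose i := chart_at m; pose j := triv_at A m.
pose y0 : 'rV[R]_(n + r) := row_mx (coord i m) (triv j m e).
pose X b := lsubmx (U (lift a b)).
have oU := @open_tdom _ _ _ _ A i j.
have oU' := @open_lsubmx _ _ r _ oU.
have ly0 : lsubmx y0 = coord i m by exact: row_mxKl.
have ry0 : rsubmx y0 = triv j m e by exact: row_mxKr.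
have Uy0 : (coord i @` (dom i `&` tdom j)) (lsubmx y0).
  by rewrite ly0; exact: center_in.
have E1 := @open_derive_eq _ _ _ _ _ _ y0 (U a) oU' Uy0
  (fun y ijy => local_rep_Lam (U \o lift a) ijy).
have E2 := @derive_fibre_linear _ _ _ _ (fun x e => mu_rep i j x e X) oU
  (fun x c e e' => @mu_rep_linear i j x c e e' X)
  (fun e => @mu_rep_smooth i j e X) y0 (U a) Uy0.
apply: etrans E1 _; apply: etrans E2 _.
rewrite /= ly0 ry0; congr (_ + _).
rewrite /mu_rep (atlas_coordK MS (atlas_dom_chart_at MS m)).
by congr (mu _ _); apply/funext => b; exact: dparam_chart_at.
Qed.

Lemma mu_deriv_linear m c (e e' : A m) w X :
  mu_deriv (c *: e + e') w X = c * mu_deriv e w X + mu_deriv e' w X.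
Proof.
have d e0 := smooth_on_differentiable
  (@mu_rep_smooth (chart_at m) (triv_at A m) e0 X) (center_in m).
rewrite /mu_deriv -(deriveMcl c w (d _)) -deriveD; last 2 first.
- by apply/diff_derivable; apply: differentiableZ.
- exact/diff_derivable.
apply: (open_derive_eq w (@open_tdom _ _ _ _ A _ _) (center_in m)) => x ijx.
by rewrite linearP (mu_rep_linear _ _ _ _ ijx).
Qed.

Lemma mu_deriv0 m (e : A m) X : mu_deriv e 0 X = 0.
Proof. exact: derive0. Qed.

(** The differentiated function is identically zero near the point, since [dparam] sends [0] to [0]
    there. *)
Lemma mu_deriv_eq0 m (e : A m) w X b : X b = 0 -> mu_deriv e w X = 0.
Proof.
move=> Xb; rewrite -(derive_cst (0 : R) (coord (chart_at m) m) w).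
apply: (open_derive_eq w (@open_tdom _ _ _ _ A _ _) (center_in m)) => x ijx.
rewrite /mu_rep; have [muA _ _] := muV.
by apply: (multilinear_eq0 (muA _ _).1 (a := b)); rewrite Xb dparam0.
Qed.

End PulledBackForms.

(** * Linear forms *)

Section AppendLast.
Context {T : Type} {l : nat}.
Implicit Types (U : 'I_l -> T) (W : T) (V : 'I_l.+1 -> T).

(** The argument list used in [sharp]: [sharp L u U W] is convertible to [L u (append_last U W)]. *)
Definition append_last U W : 'I_l.+1 -> T :=
  fun a => oapp U W (unlift ord_max a).

Lemma append_last_lift U W b : append_last U W (lift ord_max b) = U b.
Proof. by rewrite /append_last liftK. Qed.

Lemma append_last_max U W : append_last U W ord_max = W.
Proof. by rewrite /append_last unlift_none. Qed.

Lemma append_last_eta V : append_last (V \o lift ord_max) (V ord_max) = V.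
Proof.
by apply/funext => a; rewrite /append_last; case: unliftP => [b ->|->].
Qed.

End AppendLast.

Lemma comp_append_last (T T' : Type) (g : T -> T') l (U : 'I_l -> T) W :
  (fun a => g (append_last U W a)) = append_last (fun b => g (U b)) (g W).
Proof. by apply/funext => a; rewrite /append_last; case: unliftP. Qed.

Lemma append_last_dfwith (T : eqType) l (U : 'I_l -> T) W b w :
  append_last (dfwith U b w) W = dfwith (append_last U W) (lift ord_max b) w.
Proof.
apply/funext => a; rewrite dfwithE /append_last.
case: unliftP => [b' ->|->] /=; first by rewrite dfwithE (inj_eq (@lift_inj _ _)).
by rewrite (negPf (neq_lift _ _)).
Qed.

Section FormCombination.
Context {R : realType} {N k : nat} {X : atlas R N}.

Lemma is_form_comb (XS : smooth_atlas X) (c : R) (om om' : pform X k) :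
  is_form om -> is_form om' -> is_form (fun u U => om u U + c * om' u U).
Proof.
move=> [omA omC] [omA' omC']; split=> [x|i v].
  have [omM om0] := omA x; have [omM' om0'] := omA' x.
  split=> [v a d w w'|v a b ab vab].
    by rewrite omM omM' !mulrDr addrACA (mulrCA c).
  by rewrite (om0 _ _ _ ab vab) (om0' _ _ _ ab vab) mulr0 addr0.
have oU := open_coord_dom XS i.
exact: smooth_onD (omC i v) (smooth_onM oU (smooth_on_cst _ c) (omC' i v)).
Qed.

End FormCombination.

Section LinearForms.
Context {R : realType} {n r : nat} {M : manifold R n} {A : vbundle M r} {l : nat}.
Notation E := (total_space A).
Notation TE := 'rV[R]_(n + r).
Implicit Types (L : pform E l.+1) (m : M).
Implicit Types (lam : forall m : M, ('I_l -> 'rV[R]_n) -> A m -> R).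

Let MS := manifold_smooth_atlas M.
Let ES := total_smooth_atlas A.

(* [linear_form_over], with its equalities of covectors evaluated pointwise and
   without the linearity of [lam m X]. *)
Record covers L lam : Prop := {
  covers_form : is_form L;
  covers_vertical : forall m (u e : A m) (U : 'I_l -> TE),
    L (in_total u) (append_last U (vertical e)) =
    lam m (fun a => lsubmx (U a)) e;
  covers_lincomb : forall m (u u' : A m) (U U' : 'I_l -> TE) (c : R) (W : TE),
    (forall a, lsubmx (U a) = lsubmx (U' a)) ->
    L (in_total (c *: u + u'))
      (append_last (fun a => TA_lincomb c (U a) (U' a)) W) =
    c * L (in_total u) (append_last U (row_mx (lsubmx W) 0)) +
    L (in_total u') (append_last U' (row_mx (lsubmx W) 0)) +
    L (in_total u') (append_last U' (row_mx 0 (rsubmx W))) }.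

Lemma linear_form_overP L
    (lam : forall m : M, ('I_l -> 'rV[R]_n) -> {linear A m -> R^o}) :
  linear_form_over L lam <-> covers L (fun m X e => lam m X e).
Proof.
split=> [[LF Lv Ll]|[LF Lv Ll]]; split => //.
- move=> m u e U; have := congr1 (fun f : A m -> R => f e) (Lv m u U).
  by rewrite /cot_proj /sharp => ->; congr (lam m _ e); apply/funext => a;
    exact: tmap_proj.
- move=> m u u' U U' c W UU'.
  have H a : tmap (@proj R n r M A) (in_total u) (U a) =
      tmap (@proj R n r M A) (in_total u') (U' a).
    by rewrite !tmap_proj UU'.
  exact: (congr1 (fun f : TE -> R => f W) (Ll m u u' U U' c H)).
- move=> m u U; apply/funext => e.
  apply: etrans (Lv m u e U) _; congr (lam m _ e).
  by apply/funext => a; rewrite tmap_proj.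
- move=> m u u' U U' c UU'; apply/funext => W; apply: Ll => a.
  by have := UU' a; rewrite !tmap_proj.
Qed.

Lemma covers_comb (c : R) L L' lam lam' : covers L lam -> covers L' lam' ->
  covers (fun u U => L u U + c * L' u U) (fun m X e => lam m X e + c * lam' m X e).
Proof.
move=> [LF Lv Ll] [LF' Lv' Ll']; split; first exact: is_form_comb.
  by move=> m u e U; rewrite Lv Lv'.
move=> m u u' U U' d W UU'; rewrite Ll // Ll' // !mulrDr (mulrCA c).
by rewrite addrACA; congr (_ + _); rewrite addrACA.
Qed.

(** Every [X] is the projection of the vectors [row_mx (X a) 0], so the values of [lam] are read off
    from [L], here on the zero section. *)
Lemma covers_unique L lam lam' : covers L lam -> covers L lam' -> lam = lam'.
Proof.
move=> Lc Lc'; apply/functional_extensionality_dep => m.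
apply/funext => X; apply/funext => e.
have H : (fun a => lsubmx (row_mx (X a) 0 : TE)) = X.
  by apply/funext => a; exact: row_mxKl.
have := covers_vertical Lc 0 e (fun a => row_mx (X a) 0).
by rewrite (covers_vertical Lc') H.
Qed.

(** [Lam nu] sees its arguments only through their projections, which [TA_lincomb] leaves unchanged,
    and a vertical vector projects to [0]. *)
Lemma covers_Lam (nu : fiber_map A l.+1) : vb_morphism nu ->
  covers (Lam nu) (fun m X e => 0).
Proof.
move=> nuV; have [nuA nuL _] := nuV; split; first exact: is_form_Lam.
  move=> m u e U; rewrite LamE; have [nuM _] := nuA m u.
  apply: (multilinear_eq0 nuM (a := ord_max)).
  by rewrite append_last_max row_mxKl.
move=> m u u' U U' c W UU'; rewrite !LamE /= !comp_append_last.
rewrite !row_mxKl; have [nuM' _] := nuA m u'.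
have -> : (fun b => lsubmx (TA_lincomb c (U b) (U' b))) = fun b => lsubmx (U' b).
  by apply/funext => b; rewrite row_mxKl.
rewrite nuL [X in _ = _ + X](multilinear_eq0 nuM' (a := ord_max)); last first.
  by rewrite append_last_max.
by rewrite addr0 (funext UU').
Qed.

Section ExtdCovers.
Variable mu : fiber_map A l.
Hypothesis muV : vb_morphism mu.

Let muM m (e : A m) : multilinear (mu e).
Proof. by case: muV => /(_ m e)[]. Qed.

Let lift_hit (a : 'I_l.+1) : a != ord_max -> exists b, lift a b = ord_max.
Proof. by case: (unliftP a ord_max) => [b ->|->]; [exists b|rewrite eqxx]. Qed.

Let mu0 m X : mu (0 : A m) X = 0.
Proof.
have [_ muL _] := muV; have := muL m 1 0 0 X.
by rewrite scaler0 addr0 mul1r => /eqP; rewrite -subr_eq0 opprD addNKr oppr_eq0 => /eqP.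
Qed.

(** If [a] is not [ord_max], the vertical vector [W] stays among the arguments and kills the term;
    for [a = ord_max] the base derivative is along [0], and only the fibre substitution survives,
    with sign [(-1) ^+ l]. *)
Lemma extd_Lam_append m (e : A m) (U : 'I_l -> TE) (W : TE) : lsubmx W = 0 ->
  extd (Lam mu) (in_total e) (append_last U W) =
  (-1) ^+ l * mu (triv_inv (triv_at A m) m (rsubmx W)) (fun b => lsubmx (U b)).
Proof.
move=> W0; rewrite (extd_Lam muV) (bigD1 ord_max) //= append_last_max W0.
rewrite mu_deriv0 add0r big1 ?addr0; last first.
  move=> a /lift_hit[b ab]; rewrite (mu_deriv_eq0 muV _ _ (b := b)).
    rewrite (multilinear_eq0 (@muM m _) (a := b)) ?addr0 ?mulr0 //.
    by rewrite ab append_last_max.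
  by rewrite ab append_last_max.
congr (_ * mu _ _); apply/funext => b; by rewrite append_last_lift.
Qed.

Lemma covers_extd_Lam :
  covers (extd (Lam mu)) (fun m X e => (-1) ^+ l * mu e X).
Proof.
have [_ muL _] := muV; split.
- by apply: is_form_extd => //; exact: is_form_Lam.
- move=> m u e U; rewrite extd_Lam_append ?row_mxKl // row_mxKr.
  by rewrite (trivK (tdom_triv_at A m)).
move=> m u u' U U' c W UU'.
have [extdA _] := is_form_extd ES (is_form_Lam muV).
set Lu' := extd (Lam mu) (in_total u').
(* Additivity in the last slot lets the two terms at [u'] recombine into the value on the full
   vector [W]. *)
have -> : Lu' (append_last U' (row_mx (lsubmx W) 0)) =
    Lu' (append_last U' W) - Lu' (append_last U' (row_mx 0 (rsubmx W))).
  have WE : W = row_mx (lsubmx W) 0 + row_mx 0 (rsubmx W).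
    by rewrite add_row_mx addr0 add0r hsubmxK.
  have appE W' : append_last U' W' = dfwith (append_last U' 0) ord_max W'.
    apply/funext => a; rewrite dfwithE /append_last.
    by case: unliftP => [b ->|->]; rewrite ?eqxx // eq_sym (negPf (neq_lift _ _)).
  have D : Lu' (append_last U' W) = Lu' (append_last U' (row_mx (lsubmx W) 0)) +
      Lu' (append_last U' (row_mx 0 (rsubmx W))).
    apply: etrans (congr1 Lu' (appE W)) _.
    apply: etrans (congr1 (fun w => Lu' (dfwith _ ord_max w)) WE) _.
    apply: etrans (multilinearD (extdA (in_total u')).1 _ _ _ _) _.
    exact: (congr2 +%R (congr1 Lu' (esym (appE _))) (congr1 Lu' (esym (appE _)))).
  by rewrite D addrK.
rewrite -addrA subrK; rewrite /Lu' !(extd_Lam muV) mulr_sumr -big_split /=.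
apply: eq_bigr => a _; rewrite mulrCA -mulrDr; congr (_ * _).
(* All three argument lists have the same projections [Y], so only the linear dependence on the
   fibre point and on fibre components remains to be compared. *)
pose Y : 'I_l.+1 -> 'rV[R]_n := append_last (fun b => lsubmx (U' b)) (lsubmx W).
have Y0 b : lsubmx (append_last (fun a => TA_lincomb c (U a) (U' a)) W b) = Y b.
  rewrite [LHS](congr1 (fun f => f b) (comp_append_last lsubmx _ _)) /Y.
  by congr append_last; apply/funext => d; rewrite row_mxKl.
have Y1 b : lsubmx (append_last U (row_mx (lsubmx W) 0) b) = Y b.
  rewrite [LHS](congr1 (fun f => f b) (comp_append_last lsubmx _ _)) /Y.
  by rewrite row_mxKl; congr append_last; apply/funext => d; exact: UU'.
have Y2 b : lsubmx (append_last U' W b) = Y b.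
  exact: (congr1 (fun f => f b) (comp_append_last lsubmx _ _)).
(* In the last slot the list for [u] has fibre component [0] and that for [u'] has the one of [W],
   which accounts for [W] exactly once. *)
have Zr : rsubmx (append_last (fun a => TA_lincomb c (U a) (U' a)) W a) =
    c *: rsubmx (append_last U (row_mx (lsubmx W) 0) a) +
    rsubmx (append_last U' W a).
  rewrite /append_last; case: unliftP => [b _|_] /=; rewrite !row_mxKr //.
  by rewrite scaler0 add0r.
have H (V : 'I_l.+1 -> TE) : (forall b, lsubmx (V b) = Y b) ->
    (fun b => lsubmx (V (lift a b))) = Y \o lift a.
  by move=> VY; apply/funext => b; exact: VY.
rewrite Y0 Y1 Y2 (H _ Y0) (H _ Y1) (H _ Y2).
rewrite Zr (mu_deriv_linear muV) (triv_inv_linear _ _ _ (tdom_triv_at A m)) muL.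
by rewrite mulrDr addrACA.
Qed.

End ExtdCovers.

(** The horizontal lift for the splitting of [TE] given by the selected bundle chart. *)
Let hor (x : 'rV[R]_n) : TE := row_mx x 0.

Let hor_linear c x x' : hor (c *: x + x') = c *: hor x + hor x'.
Proof. by rewrite /hor scale_row_mx add_row_mx scaler0 addr0. Qed.

Let lsubmx_hor x : lsubmx (hor x) = x.
Proof. exact: row_mxKl. Qed.

Let TE_split (w : TE) : w = hor (lsubmx w) + row_mx 0 (rsubmx w).
Proof. by rewrite /hor add_row_mx addr0 add0r hsubmxK. Qed.

Let vertical_triv_inv m z : row_mx 0 z = vertical (triv_inv (triv_at A m) m z).
Proof. by rewrite /vertical (triv_invK (tdom_triv_at A m)). Qed.

(** On the zero section, [lam m X e] is the value of [L] on the horizontal lifts of [X] followed by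
    the vertical vector of [e]; alternation and smoothness are inherited from [L]. *)
Lemma covers_vb_morphism L lam : covers L lam ->
  (forall m X c (e e' : A m), lam m X (c *: e + e') = c * lam m X e + lam m X e') ->
  vb_morphism (fun m (e : A m) X => (-1) ^+ l * lam m X e).
Proof.
move=> [LF Lv _] lamL; have [LA LC] := LF.
have lamE m X (e : A m) :
    lam m X e = L (in_total (0 : A m)) (append_last (hor \o X) (vertical e)).
  by rewrite Lv; congr (lam m _ e); apply/funext => a; rewrite /= lsubmx_hor.
split=> [m e|m c e e' v|i j e v].
- have [LM L0] := LA (in_total (0 : A m)).
  pose g V := L (in_total (0 : A m)) (append_last V (vertical e)).
  have gM : multilinear g.
    by move=> V a c w w'; rewrite /g !append_last_dfwith; exact: LM.
  split=> [v a c w w'|v a b ab vab].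
    have hE w0 : lam m (dfwith v a w0) e = g (dfwith (hor \o v) a (hor w0)).
      apply: etrans (lamE _ _ _) _; congr g; exact: comp_dfwith.
    by rewrite !hE hor_linear gM mulrDr mulrCA.
  rewrite lamE (L0 _ (lift ord_max a) (lift ord_max b)) ?mulr0 //.
    by rewrite (inj_eq (@lift_inj _ _)).
  by rewrite !append_last_lift /= vab.
- by rewrite lamL mulrDr mulrCA.
have oU := @open_tdom _ _ _ _ A i j.
have oE := open_coord_dom ES (i, j).
pose V := append_last (hor \o v) (row_mx 0 e).
(* [f] is the zero section in coordinates, along which the component of [L] on the constant vectors
   [V] is smooth. *)
pose f (y : 'rV[R]_n) : TE := row_mx y 0.
have fU y : (coord i @` (dom i `&` tdom j)) y ->
    (coord ((i, j) : chart E) @` dom ((i, j) : chart E)) (f y).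
  by move=> ijy; rewrite total_coord_dom /= row_mxKl.
have fC : smooth_on (coord i @` (dom i `&` tdom j)) f.
  by apply: smooth_on_row_mx => //; [exact: smooth_on_id|exact: smooth_on_cst].
have C := smooth_onM oU (smooth_on_cst _ ((-1) ^+ l : R))
  (smooth_on_comp oU fU fC (LC (i, j) V)).
apply: smooth_on_eq oU _ C => y ijy /=; congr (_ * _).
have zE (z : TE) : (coord i @` (dom i `&` tdom j)) (lsubmx z) ->
    local_rep L ((i, j) : chart E) z V =
    lam (param i (lsubmx z)) (fun a => dparam i (lsubmx z) (v a))
      (triv_inv j (param i (lsubmx z)) e).
  move=> ijz; rewrite /local_rep.
  (* The last vector stays vertical under [dparam]. The others may acquire fibre components, but
     [Lv] retains only their projections. *)
  have -> : (fun a => dparam ((i, j) : chart E) z (V a)) =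
      append_last (fun b => dparam ((i, j) : chart E) z (hor (v b)))
        (vertical (triv_inv j (param i (lsubmx z)) e)).
    apply: etrans (comp_append_last _ _ _) _; congr append_last.
    rewrite -[LHS]hsubmxK; rewrite lsubmx_dparam // rsubmx_dparam_vertical //.
    by rewrite row_mxKl dparam0.
  apply: etrans (Lv _ _ _ _) _; congr (lam _ _ _); apply/funext => b.
  by apply: etrans (lsubmx_dparam _ ijz) _; congr (dparam _ _ _); exact: lsubmx_hor.
by have := zE (f y); rewrite /f row_mxKl => /(_ ijy).
Qed.

(* A linear form over the zero map vanishes on vertical vectors. *)
Lemma covers0_Lam L : covers L (fun m X e => 0) ->
  exists2 nu : fiber_map A l.+1, vb_morphism nu & L = Lam nu.
Proof.
move=> [LF Lv Ll]; have [LA LC] := LF.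
pose nu : fiber_map A l.+1 := fun m e X => L (in_total e) (hor \o X).
(* The covering condition gives the vanishing for a vertical last argument; a transposition moves
   any other slot there. *)
have L0 m (e : A m) (V : 'I_l.+1 -> TE) a : lsubmx (V a) = 0 ->
    L (in_total e) V = 0.
  have Lmax V' : lsubmx (V' ord_max) = 0 -> L (in_total e) V' = 0.
    move=> V0; rewrite -(append_last_eta V') [V' ord_max]TE_split V0.
    by rewrite /hor row_mx0 add0r (vertical_triv_inv m) Lv.
  have [->|am] := eqVneq a ord_max; first exact: Lmax.
  move=> Va; apply/eqP; rewrite -oppr_eq0 -(alt_swap (LA _) V am).
  by apply/eqP/Lmax; rewrite /= tpermR.
(* The arguments are replaced one at a time by their horizontal parts; the vertical remainders
   contribute zero by [L0]. *)
have Lhor m (e : A m) (V : 'I_l.+1 -> TE) :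
    L (in_total e) V = nu m e (fun a => lsubmx (V a)).
  have [LM _] := LA (in_total e).
  pose mix (s : seq 'I_l.+1) a := if a \in s then hor (lsubmx (V a)) else V a.
  suff mixE s : uniq s -> L (in_total e) V = L (in_total e) (mix s).
    rewrite (mixE _ (enum_uniq 'I_l.+1)) /nu; congr (L _ _).
    by apply/funext => a; rewrite /mix mem_enum.
  elim: s => [//|a s IHs] /= /andP[as_ us]; rewrite (IHs us).
  have -> : mix (a :: s) = dfwith (mix s) a (hor (lsubmx (V a))).
    apply/funext => b; rewrite dfwithE /mix in_cons.
    by have [->|] := eqVneq b a.
  have {1}-> : mix s = dfwith (mix s) a (hor (lsubmx (V a)) + row_mx 0 (rsubmx (V a))).
    rewrite -TE_split; apply/funext => b; rewrite dfwithE /mix.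
    by have [->|//] := eqVneq b a; rewrite (negPf as_).
  rewrite (multilinearD LM) (L0 _ _ (dfwith _ _ (row_mx 0 _)) a) ?addr0 //.
  by rewrite dfwithE eqxx row_mxKl.
exists nu; last first.
  apply/funext => -[m e]; apply/funext => U.
  exact: etrans (Lhor m e U) (esym (LamE nu (in_total e) U)).
split=> [m e|m c e e' X|i j e v].
- have [LM L0'] := LA (in_total e).
  split=> [v a c w w'|v a b ab vab].
    pose g w0 := L (in_total e) (dfwith (hor \o v) a w0).
    have hE w0 : nu m e (dfwith v a w0) = g (hor w0).
      by congr (L _ _); exact: comp_dfwith.
    by rewrite !hE hor_linear; exact: LM.
  by apply: (L0' _ a b ab); rewrite /= vab.
(* [TA_lincomb] of a horizontal vector with itself is that same vector, so the linearity condition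
   on [L] applies with equal lists over [e] and [e']. *)
- have E1 : hor \o X = append_last (fun a : 'I_l =>
      TA_lincomb c (hor (X (lift ord_max a))) (hor (X (lift ord_max a))))
      (hor (X ord_max)).
    rewrite -[LHS]append_last_eta; congr append_last; apply/funext => a.
    by rewrite /TA_lincomb /hor /= row_mxKl row_mxKr scaler0 addr0.
  have E2 : append_last (fun a : 'I_l => hor (X (lift ord_max a)))
      (row_mx (lsubmx (hor (X ord_max))) 0) = hor \o X.
    by rewrite lsubmx_hor -[RHS]append_last_eta.
  rewrite {1}/nu E1 Ll // E2 [X in _ + X](L0 _ _ _ ord_max) ?addr0 //.
  by rewrite append_last_max row_mxKl.
have oU := @open_tdom _ _ _ _ A i j.
(* The local section with constant fibre coordinates [e]; components of [nu] are those of [L] along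
   it on constant horizontal vectors. *)
pose f (y : 'rV[R]_n) : TE := row_mx y e.
have fU y : (coord i @` (dom i `&` tdom j)) y ->
    (coord ((i, j) : chart E) @` dom ((i, j) : chart E)) (f y).
  by move=> ijy; rewrite total_coord_dom /= row_mxKl.
have fC : smooth_on (coord i @` (dom i `&` tdom j)) f.
  by apply: smooth_on_row_mx => //; [exact: smooth_on_id|exact: smooth_on_cst].
have C := smooth_on_comp oU fU fC (LC (i, j) (hor \o v)).
apply: smooth_on_eq oU _ C => y ijy /=.
have zE (z : TE) : (coord i @` (dom i `&` tdom j)) (lsubmx z) ->
    local_rep L ((i, j) : chart E) z (hor \o v) =
    nu (param i (lsubmx z)) (triv_inv j (param i (lsubmx z)) (rsubmx z))
      (fun a => dparam i (lsubmx z) (v a)).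
  move=> ijz; rewrite /local_rep.
  apply: etrans (Lhor _ _ _) _; congr (nu _ _ _); apply/funext => a.
  by apply: etrans (lsubmx_dparam _ ijz) _; congr (dparam _ _ _); exact: lsubmx_hor.
by have := zE (f y); rewrite /f row_mxKl row_mxKr => /(_ ijy).
Qed.

End LinearForms.

(** * Existence and uniqueness of the decomposition *)

Section Correspondence.
Context {R : realType} {n r : nat} {M : manifold R n} {A : vbundle M r} {l : nat}.
Implicit Types (L : pform (total_space A) l.+1).
Implicit Types (mu : fiber_map A l) (nu : fiber_map A l.+1).

Lemma covers_form_of mu nu : vb_morphism mu -> vb_morphism nu ->
  covers (form_of mu nu) (fun m X e => (-1) ^+ l * mu m e X).
Proof.
move=> muV nuV.
have := covers_comb 1 (covers_extd_Lam muV) (covers_Lam nuV).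
have -> : (fun u U => extd (Lam mu) u U + 1 * Lam nu u U) = form_of mu nu.
  by apply/funext => u; apply/funext => U; rewrite mul1r.
congr covers; apply/functional_extensionality_dep => m.
by apply/funext => X; apply/funext => e; rewrite mulr0 addr0.
Qed.

Lemma covers_linear_form L
    (lam : forall m : M, ('I_l -> 'rV[R]_n) -> A m -> R) :
  (forall m X c (e e' : A m), lam m X (c *: e + e') = c * lam m X e + lam m X e') ->
  covers L lam -> linear_form L.
Proof.
move=> lamL Lc.
have lin m X : linear (lam m X : A m -> R^o) by move=> c e e'; exact: lamL.
pose lam' m X : {linear A m -> R^o} := HB.pack (lam m X : A m -> R^o)
  (GRing.isLinear.Build _ _ _ _ (lam m X : A m -> R^o) (lin m X)).
by exists lam'; apply/linear_form_overP.
Qed.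

Lemma linear_form_form_of mu nu : vb_morphism mu -> vb_morphism nu ->
  linear_form (form_of mu nu).
Proof.
move=> muV nuV; apply: covers_linear_form (covers_form_of muV nuV).
by move=> m X c e e'; case: muV => _ -> _; rewrite mulrDr mulrCA.
Qed.

Lemma Lam_inj nu nu' : Lam nu = Lam nu' -> nu = nu'.
Proof.
move=> nn'; apply/functional_extensionality_dep => m.
apply/funext => e; apply/funext => X.
have := congr1 (fun L : pform (total_space A) l.+1 =>
  L (in_total e) (fun a => row_mx (X a) 0)) nn'.
rewrite !LamE /=.
have -> : (fun a => lsubmx (row_mx (X a) 0 : 'rV[R]_(n + r))) = X.
  by apply/funext => a; exact: row_mxKl.
by [].
Qed.

(** Uniqueness of the covered map gives [lam m X e = (-1) ^+ l * mu m e X], and the sign is its own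
    inverse. *)
Lemma form_of_covered L (lam : forall m : M, ('I_l -> 'rV[R]_n) -> A m -> R)
    mu nu : covers L lam -> vb_morphism mu -> vb_morphism nu ->
  L = form_of mu nu -> mu = fun m e X => (-1) ^+ l * lam m X e.
Proof.
move=> + muV nuV LE; rewrite LE => /covers_unique /(_ (covers_form_of muV nuV)) ->.
apply/functional_extensionality_dep => m; apply/funext => e; apply/funext => X.
by rewrite mulrA -expr2 sqrr_sign mul1r.
Qed.

Lemma form_of_inj mu mu' nu nu' : vb_morphism mu -> vb_morphism nu ->
  vb_morphism mu' -> vb_morphism nu' ->
  form_of mu nu = form_of mu' nu' -> mu = mu' /\ nu = nu'.
Proof.
move=> muV nuV muV' nuV' E.
(* The form built from [mu'] and [nu'] covers a map determined by [mu']; by the equality of forms,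
   [mu] is recovered from that same map. *)
have mumu' : mu = mu'.
  rewrite (form_of_covered (covers_form_of muV' nuV') muV nuV (esym E)).
  apply/functional_extensionality_dep => m; apply/funext => e; apply/funext => X.
  by rewrite mulrA -expr2 sqrr_sign mul1r.
split => //; apply: Lam_inj; apply/funext => u; apply/funext => U.
have := congr1 (fun L : pform (total_space A) l.+1 => L u U) E.
by rewrite /form_of mumu' => /addrI.
Qed.

Lemma form_of_surj L : linear_form L -> exists mu nu,
  [/\ vb_morphism mu, vb_morphism nu & L = form_of mu nu].
Proof.
move=> [lam /linear_form_overP Lc].
pose mu : fiber_map A l := fun m e X => (-1) ^+ l * lam m X e.
have muV : vb_morphism mu.
  by apply: (covers_vb_morphism Lc) => m X c e e'; exact: linearP.
(* The difference of [L] and [extd (Lam mu)] covers [lam] minus [(-1) ^+ l * (-1) ^+ l] times [lam],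
   which is zero. *)
have := covers_comb (-1) Lc (covers_extd_Lam muV).
have -> : (fun m X e => lam m X e + (-1) * ((-1) ^+ l * mu m e X)) =
    (fun m X e => 0) :> (forall m : M, ('I_l -> 'rV[R]_n) -> A m -> R).
  apply/functional_extensionality_dep => m; apply/funext => X; apply/funext => e.
  by rewrite /mu !mulrA -[_ * _ * (-1) ^+ l]mulrA -expr2 sqrr_sign mulr1 mulN1r subrr.
move=> /covers0_Lam[nu nuV LE]; exists mu, nu; split => //.
apply/funext => u; apply/funext => U.
have := congr1 (fun L' : pform (total_space A) l.+1 => L' u U) LE.
by rewrite /form_of => <-; rewrite mulN1r addrC subrK.
Qed.

End Correspondence.

(* k = l.+1 *)
Theorem proposition2p5 (R : realType) (n r : nat) (M : manifold R n)
    (A : vbundle M r) (l : nat) :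
  set_bij
    [set p : fiber_map A l * fiber_map A l.+1 |
       vb_morphism p.1 /\ vb_morphism p.2]
    [set L : pform (total_space A) l.+1 | linear_form L]
    (fun p => form_of p.1 p.2)
  /\
  (forall (L : pform (total_space A) l.+1)
     (lam : forall m : M, ('I_l -> 'rV[R]_n) -> {linear A m -> R^o})
     (mu : fiber_map A l) (nu : fiber_map A l.+1),
     linear_form_over L lam -> vb_morphism mu -> vb_morphism nu ->
     L = form_of mu nu ->
     forall (m : M) (e : A m) (X : 'I_l -> 'rV[R]_n),
       mu m e X = (-1) ^+ l * lam m X e).
Proof.
split; last first.
  move=> L lam mu nu /linear_form_overP Lc muV nuV LE m e X.
  by rewrite (form_of_covered Lc muV nuV LE).
split.
- by move=> [mu nu] /= [muV nuV]; exact: linear_form_form_of.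
- move=> [mu nu] [mu' nu'] /set_mem/= [muV nuV] /set_mem/= [muV' nuV'] E.
  by have [-> ->] := form_of_inj muV nuV muV' nuV' E.
by move=> L /= /form_of_surj[mu [nu [muV nuV ->]]]; exists (mu, nu).
Qed.
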